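(* Let $Y$ be the total space of the negative spinor bundle on the round $S^4$, equipped with the $Spin(7)$-holonomy metric of Bryant and Salamon, given by the $4$-form $\Psi$. Let $\mathcal E_Y$ be the associated principal $SU(2)$-bundle on $Y$, and let $f(r)$ be the function $$f(r)=\frac{1}{r\big(1+D(1+r)^{3/5}\big)}+\frac{D(2r+5)}{5r(1+r)^{2/5}\big(1+D(1+r)^{3/5}\big)},$$ where $D>-1$ is a constant. Then the connection $A=\phi+f(r)A_2$, with $A_2=\mathrm{Im}(\bar a\alpha)$ and $r=a\bar a$, defines a non-trivial $Spin(7)$-instanton on $\mathcal E_Y$ with structure group $SU(2)$. Here the connection form $A$ is defined only away from the set $\{r=0\}$ in $Y$, that is, away from the image of the zero section of the negative spinor bundle.
   Context: Conventions. $\mathbb H$ denotes the quaternions, $SU(2)$ the unit quaternions, $\mathrm{Im}\,\mathbb H\cong\mathfrak{su}(2)$. Products of $\mathbb H$-valued forms are wedge products combined with quaternion multiplication. Upper multi-indices denote wedge products, e.g. $\alpha^{01}=\alpha^0\wedge\alpha^1$. The manifold. Let $\mathcal F\to S^4$ be the spin double cover of the orthonormal coframe bundle of the round $S^4$, a principal right $Spin(4)=SU(2)\times SU(2)$-bundle, with canonical $\mathbb H$-valued $1$-form $\omega=\omega^0+\omega^1i+\omega^2j+\omega^3k$. The Levi-Civita connection consists of two $\mathrm{Im}\,\mathbb H$-valued $1$-forms $\xi,\phi$ (for the first and second $SU(2)$ factors) with $d\omega=-\xi\wedge\omega-\omega\wedge\phi$. With $\Omega=\frac12\bar\omega\wedge\omega=\Omega^1i+\Omega^2j+\Omega^3k$,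 where $\Omega^1=\omega^{01}-\omega^{23}$, $\Omega^2=\omega^{02}-\omega^{31}$, $\Omega^3=\omega^{03}-\omega^{12}$, one has $d\phi+\phi\wedge\phi=\frac\kappa2\Omega$ for a constant $\kappa>0$. The negative spinor bundle is $Y=(\mathcal F\times\mathbb H)/Spin(4)$, associated to the representation $((p,q),v)\mapsto v\bar q$ of $Spin(4)$ on $\mathbb H$ (so the right action on $\mathcal F\times\mathbb H$ is $(u,v)\cdot(p,q)=(u\cdot(p,q),vq)$). The map $a:\mathcal F\times\mathbb H\to\mathbb H$ is the projection, $r=a\bar a$ is the squared fibre radius, $\alpha=da-a\phi=\alpha^0+\alpha^1i+\alpha^2j+\alpha^3k$, and $B=\frac12\bar\alpha\wedge\alpha=B^1i+B^2j+B^3k$ with $B^1=\alpha^{01}-\alpha^{23}$, $B^2=\alpha^{02}-\alpha^{31}$, $B^3=\alpha^{03}-\alpha^{12}$. The $Spin(7)$-structure. $\Psi=\sigma^2\Psi_1+\sigma\tau\Psi_2+\tau^2\Psi_3$, where $\Psi_1=\alpha^{0123}$, $\Psi_2=B^1\wedge\Omega^1+B^2\wedge\Omega^2+B^3\wedge\Omega^3$, $\Psi_3=\omega^{0123}$, $\sigma=4(1+r)^{-2/5}$, $\tau=5\kappa(1+r)^{3/5}$. These forms descend to $Y$, and $\Psi$ is closed. The associated metric is $g_\Psi=\sigma\sum_i(\alpha^i)^2+\tau\sum_i(\omega^i)^2$, which has holonomy $Spin(7)$; the orientation is given by $\alpha^{0123}\wedge\omega^{0123}$, and $*$ is the Hodge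 operator. The bundle. $\mathcal E_Y=(\mathcal F\times\mathbb H)/(SU(2)\times\{1\})$ is a principal $SU(2)$-bundle over $Y$ (structure group the second factor). The form $\phi$, pulled back from the Levi-Civita connection of the round metric, descends to a connection form on $\mathcal E_Y$, and $A_2=\mathrm{Im}(\bar a\alpha)$ descends to an equivariant $\mathfrak{su}(2)$-valued $1$-form on $\mathcal E_Y$ vanishing on vertical vectors. The curvature of $A$ is $F_A=dA+A\wedge A$. A $Spin(7)$-instanton is a connection $A$ whose curvature satisfies $*(\Psi\wedge F_A)=F_A$.
   Formalization: Non-triviality (non-flatness) is claimed only for D ≠ 0, since A is flat at D = 0; for -1 < D < 0, f has a second pole where 1 + D(1+r)^{3/5} = 0, so the instanton claim is made on {r ≠ 0} minus that set; for D ≥ 0 it holds on all of {r ≠ 0}. *)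

(* Defs.v *)
From Stdlib Require Import Reals List Lra Lia.
From Coquelicot Require Import Coquelicot.
Import ListNotations.
Open Scope R_scope.

(** * Quaternions *)

(* (x0,x1,x2,x3) stands for x0 + x1 i + x2 j + x3 k.  The product type carries
   Coquelicot's normed module structure (plus, opp, scal, continuity). *)
Definition quat : Type := (R * R * R * R)%type.

Definition q0 (x : quat) : R := fst (fst (fst x)).
Definition q1 (x : quat) : R := snd (fst (fst x)).
Definition q2 (x : quat) : R := snd (fst x).
Definition q3 (x : quat) : R := snd x.

Definition qreal (c : R) : quat := (c, 0, 0, 0).
Definition qadd (x y : quat) : quat :=
  (q0 x + q0 y, q1 x + q1 y, q2 x + q2 y, q3 x + q3 y).
Definition qopp (x : quat) : quat := (- q0 x, - q1 x, - q2 x, - q3 x).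
Definition qscal (c : R) (x : quat) : quat :=
  (c * q0 x, c * q1 x, c * q2 x, c * q3 x).
Definition qmul (x y : quat) : quat :=
  (q0 x * q0 y - q1 x * q1 y - q2 x * q2 y - q3 x * q3 y,
   q0 x * q1 y + q1 x * q0 y + q2 x * q3 y - q3 x * q2 y,
   q0 x * q2 y - q1 x * q3 y + q2 x * q0 y + q3 x * q1 y,
   q0 x * q3 y + q1 x * q2 y - q2 x * q1 y + q3 x * q0 y).
Definition qconj (x : quat) : quat := (q0 x, - q1 x, - q2 x, - q3 x).
Definition qim (x : quat) : quat := (0, q1 x, q2 x, q3 x).
Definition qnorm2 (x : quat) : R :=
  q0 x * q0 x + q1 x * q1 x + q2 x * q2 x + q3 x * q3 x.

Definition imaginary (x : quat) : Prop := q0 x = 0.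
Definition SU2 (p : quat) : Prop := qmul (qconj p) p = qreal 1.

(** * 2 x 2 quaternionic matrices *)

(* ((m11, m12), (m21, m22)) *)
Definition mat2 : Type := ((quat * quat) * (quat * quat))%type.

Definition m11 (g : mat2) : quat := fst (fst g).
Definition m12 (g : mat2) : quat := snd (fst g).
Definition m21 (g : mat2) : quat := fst (snd g).
Definition m22 (g : mat2) : quat := snd (snd g).

Definition mdiag (p q : quat) : mat2 := ((p, qreal 0), (qreal 0, q)).
Definition mopp (g : mat2) : mat2 :=
  ((qopp (m11 g), qopp (m12 g)), (qopp (m21 g), qopp (m22 g))).
Definition mmul (g h : mat2) : mat2 :=
  ((qadd (qmul (m11 g) (m11 h)) (qmul (m12 g) (m21 h)),
    qadd (qmul (m11 g) (m12 h)) (qmul (m12 g) (m22 h))),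
   (qadd (qmul (m21 g) (m11 h)) (qmul (m22 g) (m21 h)),
    qadd (qmul (m21 g) (m12 h)) (qmul (m22 g) (m22 h)))).
Definition madj (g : mat2) : mat2 :=
  ((qconj (m11 g), qconj (m21 g)), (qconj (m12 g), qconj (m22 g))).

(** * The total space [F x H] *)

(* The spin double cover F of the oriented orthonormal coframe bundle of the
   round S^4 of sectional curvature kappa is Sp(2) -> Sp(2)/(SU(2) x SU(2)),
   with Spin(4) = SU(2) x SU(2) acting on the right through diagonal matrices;
   see base_orbits, base_surjective, omega_isometry, coframe_kernel and the
   structure equations below.  F x H is thus a submanifold of the real vector
   space [point] of dimension 20.  A differential form on (an open part of)
   F x H is represented by a form on (an open part of) [point], of which only
   the values on points and tangent vectors of F x H matter; the exterior
   derivative commutes with this restriction. *)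
Definition point : Type := (mat2 * quat)%type.
Notation vect := point (only parsing).

Definition Sp2 (g : mat2) : Prop :=
  mmul (madj g) g = mdiag (qreal 1) (qreal 1) /\
  mmul g (madj g) = mdiag (qreal 1) (qreal 1).

Definition total (x : point) : Prop := Sp2 (fst x).

(* T_g Sp(2) = { v | g^* v is skew-Hermitian }; no condition on the H part. *)
Definition tangent (x : point) (v : vect) : Prop :=
  madj (mmul (madj (fst x)) (fst v)) = mopp (mmul (madj (fst x)) (fst v)).

(* (u, a) . (p, q) = (u . (p, q), a q).  The action is linear, hence is its own
   differential, and is also used below on tangent vectors. *)
Definition act (p q : quat) (x : point) : point :=
  (mmul (fst x) (mdiag p q), qmul (snd x) q).

(* The value at x of the fundamental vector field of (X, Y) in su(2) + su(2). *)
Definition vertical (X Y : quat) (x : point) : vect :=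
  (mmul (fst x) (mdiag X Y), qmul (snd x) Y).

(** * Forms *)

(* An element of the exterior algebra of V^* with coefficients in T is given by
   its values on all finite lists of vectors; a k-form is 0 on the lists whose
   length is not k. *)
Definition alt (V T : Type) : Type := list V -> T.
Definition form (T : Type) : Type := point -> alt vect T.

Definition lin1 {V : Type} {T : AbelianMonoid} (c : V -> T) : alt V T :=
  fun vs => match vs with [v] => c v | _ => zero end.

(* All the ways of separating a list into two complementary sublists, with the
   sign of the corresponding shuffle. *)
Fixpoint unshuffles {V : Type} (vs : list V) : list (R * list V * list V) :=
  match vs with
  | [] => [(1, [], [])]
  | v :: vs' =>
      flat_map (fun '(s, l, r) =>
                  [(s, v :: l, r); ((-1) ^ length l * s, l, v :: r)])
               (unshuffles vs')
  end.

Definition lsum {T : AbelianMonoid} (l : list T) : T := fold_right plus zero l.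

(* Normalised so that (a /\ b)(v, w) = a(v) b(w) - a(w) b(v) for 1-forms. *)
Definition wedge {V A B : Type} {C : ModuleSpace R_Ring} (mul : A -> B -> C)
    (a : alt V A) (b : alt V B) : alt V C :=
  fun vs => lsum (map (fun '(s, l, r) => scal s (mul (a l) (b r)))
                      (unshuffles vs)).

Definition wedgeR {V : Type} (a b : alt V R) : alt V R :=
  wedge (C := R_ModuleSpace) Rmult a b.

Definition quat_ModuleSpace : ModuleSpace R_Ring :=
  prod_ModuleSpace R_Ring (prod_ModuleSpace R_Ring (prod_ModuleSpace R_Ring
    R_ModuleSpace R_ModuleSpace) R_ModuleSpace) R_ModuleSpace.

Definition wedgeH {V : Type} (a b : alt V quat) : alt V quat :=
  wedge (C := quat_ModuleSpace) qmul a b.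

Definition wedgeRH {V : Type} (a : alt V R) (b : alt V quat) : alt V quat :=
  wedge (C := quat_ModuleSpace) qscal a b.

Definition quat_lin1 {V : Type} (c : V -> quat) : alt V quat :=
  lin1 (T := quat_ModuleSpace) c.

Definition dirD (f : point -> R) (v : vect) (x : point) : R :=
  Derive (fun t => f (plus x (scal t v))) 0.

Definition dirDq (f : point -> quat) (v : vect) (x : point) : quat :=
  (dirD (fun y => q0 (f y)) v x, dirD (fun y => q1 (f y)) v x,
   dirD (fun y => q2 (f y)) v x, dirD (fun y => q3 (f y)) v x).

(* d a (v_0, ..., v_k) = sum_i (-1)^i D_{v_i} (a (v_0, .., v_i omitted, .., v_k)),
   the v_i being constant vector fields on [point]. *)
Definition extd (a : form quat) : form quat := fun x vs =>
  lsum (T := quat_ModuleSpace)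
    (map (fun i => qscal ((-1) ^ i)
            (dirDq (fun y => a y (firstn i vs ++ skipn (S i) vs))
                   (nth i vs zero) x))
         (seq 0 (length vs))).

Fixpoint Ck (k : nat) (U : point -> Prop) (f : point -> R) : Prop :=
  (forall x, U x -> continuous f x) /\
  match k with
  | O => True
  | S k' => forall v,
      (forall x, U x -> ex_derive (fun t => f (plus x (scal t v))) 0) /\
      Ck k' U (dirD f v)
  end.

Definition smooth (U : point -> Prop) (f : point -> R) : Prop :=
  forall k, Ck k U f.

Definition smoothq (U : point -> Prop) (f : point -> quat) : Prop :=
  smooth U (fun x => q0 (f x)) /\ smooth U (fun x => q1 (f x)) /\
  smooth U (fun x => q2 (f x)) /\ smooth U (fun x => q3 (f x)).

(** * Canonical form and Levi-Civita connection *)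

(* g^* dg = (xi , (sqrt kappa / 2) omega ; - (sqrt kappa / 2) bar omega , phi) *)
Definition maurer_cartan (x : point) (v : vect) : mat2 :=
  mmul (madj (fst x)) (fst v).

Definition xi (x : point) (v : vect) : quat := m11 (maurer_cartan x v).
Definition phi (x : point) (v : vect) : quat := m22 (maurer_cartan x v).
Definition omega (kappa : R) (x : point) (v : vect) : quat :=
  qscal (2 / sqrt kappa) (m12 (maurer_cartan x v)).

Definition fibre (x : point) : quat := snd x.
Definition radius2 (x : point) : R := q0 (qmul (fibre x) (qconj (fibre x))).

(* alpha = da - a phi *)
Definition alpha (x : point) (v : vect) : quat :=
  qadd (snd v) (qopp (qmul (fibre x) (phi x v))).

(** * The Spin(7)-structure *)

(* The four real components of a quaternion-valued linear form. *)
Definition e0 {V : Type} (c : V -> quat) : alt V R := lin1 (T := R_ModuleSpace) (fun v => q0 (c v)).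
Definition e1 {V : Type} (c : V -> quat) : alt V R := lin1 (T := R_ModuleSpace) (fun v => q1 (c v)).
Definition e2 {V : Type} (c : V -> quat) : alt V R := lin1 (T := R_ModuleSpace) (fun v => q2 (c v)).
Definition e3 {V : Type} (c : V -> quat) : alt V R := lin1 (T := R_ModuleSpace) (fun v => q3 (c v)).

Definition e0123 {V : Type} (c : V -> quat) : alt V R :=
  wedgeR (wedgeR (wedgeR (e0 c) (e1 c)) (e2 c)) (e3 c).

(* The components of (1/2) (bar c) /\ c: they are Omega^i for c = omega and B^i
   for c = alpha. *)
Definition asd1 {V : Type} (c : V -> quat) : alt V R :=
  fun vs => wedgeR (e0 c) (e1 c) vs - wedgeR (e2 c) (e3 c) vs.
Definition asd2 {V : Type} (c : V -> quat) : alt V R :=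
  fun vs => wedgeR (e0 c) (e2 c) vs - wedgeR (e3 c) (e1 c) vs.
Definition asd3 {V : Type} (c : V -> quat) : alt V R :=
  fun vs => wedgeR (e0 c) (e3 c) vs - wedgeR (e1 c) (e2 c) vs.
Definition asd {V : Type} (c : V -> quat) : alt V quat :=
  fun vs => (0, asd1 c vs, asd2 c vs, asd3 c vs).

Definition sigma (r : R) : R := 4 * Rpower (1 + r) (- (2 / 5)).
Definition tau (kappa r : R) : R := 5 * kappa * Rpower (1 + r) (3 / 5).

Definition Psi1 : form R := fun x => e0123 (alpha x).
Definition Psi2 (kappa : R) : form R := fun x vs =>
  wedgeR (asd1 (alpha x)) (asd1 (omega kappa x)) vs +
  wedgeR (asd2 (alpha x)) (asd2 (omega kappa x)) vs +
  wedgeR (asd3 (alpha x)) (asd3 (omega kappa x)) vs.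
Definition Psi3 (kappa : R) : form R := fun x => e0123 (omega kappa x).

Definition Psi (kappa : R) : form R := fun x vs =>
  let s := sigma (radius2 x) in
  let t := tau kappa (radius2 x) in
  s ^ 2 * Psi1 x vs + s * t * Psi2 kappa x vs + t ^ 2 * Psi3 kappa x vs.

Definition qdot (x y : quat) : R :=
  q0 x * q0 y + q1 x * q1 y + q2 x * q2 y + q3 x * q3 y.

(* The metric g_Psi of Y, pulled back to F x H. *)
Definition gPsi (kappa : R) (x : point) (v w : vect) : R :=
  sigma (radius2 x) * qdot (alpha x v) (alpha x w) +
  tau kappa (radius2 x) * qdot (omega kappa x v) (omega kappa x w).

Definition orientation (kappa : R) : form R := fun x =>
  wedgeR (e0123 (alpha x)) (e0123 (omega kappa x)).

(* T_y Y is the quotient of T_x (F x H) by the tangent space of the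
   Spin(4)-orbit.  [E] is a list of lifts to T_x (F x H) of the vectors of a
   positively oriented orthonormal basis of T_y Y, in order. *)
Record oriented_orthonormal_frame (kappa : R) (x : point) (E : list vect) : Prop := {
  frame_dim : length E = 8%nat;
  frame_tangent : forall v, In v E -> tangent x v;
  frame_orthonormal : forall i j, (i < 8)%nat -> (j < 8)%nat ->
    gPsi kappa x (nth i E zero) (nth j E zero) = if Nat.eqb i j then 1 else 0;
  frame_oriented : 0 < orientation kappa x E
}.

(* H = * G at the point of Y below x, for G of degree k: for every oriented
   orthonormal basis, ( *G)(E_{k+1}, ..., E_8) = G(E_1, ..., E_k). *)
Definition is_hodge_star (kappa : R) (x : point) (k : nat) (G H : alt vect quat) : Prop :=
  forall E, oriented_orthonormal_frame kappa x E -> H (skipn k E) = G (firstn k E).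

(** * Connections on the bundle over Y *)

(* The bundle E_Y is (F x H)/(SU(2) x {1}), with structure group the second
   factor SU(2).  Forms on it are the forms on F x H which are invariant under
   SU(2) x {1} and vanish on the vectors tangent to its orbits.  U is the part
   of the total space where the connection is defined. *)
Record is_connection (U : point -> Prop) (A : point -> vect -> quat) : Prop := {
  conn_plus : forall x v w, U x -> A x (plus v w) = qadd (A x v) (A x w);
  conn_scal : forall x c v, U x -> A x (scal c v) = qscal c (A x v);
  conn_smooth : forall v, smoothq U (fun x => A x v);
  conn_imaginary : forall x v, total x -> U x -> tangent x v -> imaginary (A x v);
  conn_descends_vertical : forall x X, total x -> U x -> imaginary X ->
    A x (vertical X (qreal 0) x) = qreal 0;
  conn_descends_invariant : forall x v p, total x -> U x -> tangent x v -> SU2 p ->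
    A (act p (qreal 1) x) (act p (qreal 1) v) = A x v;
  conn_vertical : forall x X, total x -> U x -> imaginary X ->
    A x (vertical (qreal 0) X x) = X;
  conn_equivariant : forall x v q, total x -> U x -> tangent x v -> SU2 q ->
    A (act (qreal 1) q x) (act (qreal 1) q v) = qmul (qmul (qconj q) (A x v)) q
}.

(* F_A = dA + A /\ A *)
Definition curvature (A : point -> vect -> quat) : form quat := fun x vs =>
  qadd (extd (fun y => quat_lin1 (A y)) x vs)
       (wedgeH (quat_lin1 (A x)) (quat_lin1 (A x)) vs).

(* *(Psi /\ F_A) = F_A *)
Definition is_Spin7_instanton (kappa : R) (U : point -> Prop)
    (A : point -> vect -> quat) : Prop :=
  is_connection U A /\
  forall x, total x -> U x ->
    is_hodge_star kappa x 6 (wedgeRH (Psi kappa x) (curvature A x)) (curvature A x).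

Definition is_flat (U : point -> Prop) (A : point -> vect -> quat) : Prop :=
  forall x v w, total x -> U x -> tangent x v -> tangent x w ->
    curvature A x [v; w] = qreal 0.

(** * The connection *)

Definition f (D r : R) : R :=
  1 / (r * (1 + D * Rpower (1 + r) (3 / 5))) +
  D * (2 * r + 5) /
    (5 * r * Rpower (1 + r) (2 / 5) * (1 + D * Rpower (1 + r) (3 / 5))).

Definition A2 (x : point) (v : vect) : quat :=
  qim (qmul (qconj (fibre x)) (alpha x v)).

Definition Aconn (D : R) (x : point) (v : vect) : quat :=
  qadd (phi x v) (qscal (f D (radius2 x)) (A2 x v)).

Definition off_zero_section (x : point) : Prop := radius2 x <> 0.

(* Where the denominators of f do not vanish.  For D >= 0 this is just
   [off_zero_section]; for -1 < D < 0 the function f has a second pole, at the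
   r > 0 with D (1 + r)^(3/5) = -1. *)
Definition domain (D : R) (x : point) : Prop :=
  off_zero_section x /\ 1 + D * Rpower (1 + radius2 x) (3 / 5) <> 0.

(** * The model *)

Ltac qext :=
  repeat match goal with
    | x : quat |- _ => destruct x as [[[? ?] ?] ?]
    end;
  cbv beta iota delta
    [qreal qadd qopp qscal qmul qconj qim qnorm2 qdot q0 q1 q2 q3 fst snd] in *.
Ltac qpair :=
  repeat apply (f_equal2 (@pair _ _));
  match goal with
  | |- @eq (prod _ _) _ _ => idtac
  | |- @eq ?T ?a ?b => try change (@eq R a b)
  end.
Ltac qring :=
  intros; qext; qpair; ring.
Ltac mring :=
  intros;
  repeat match goal with
    | g : mat2 |- _ => destruct g as [[? ?] [? ?]]
    end;
  unfold mmul, madj, mdiag, mopp, m11, m12, m21, m22; cbn [fst snd];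
  qpair; qring.

Lemma qmul_assoc p q r : qmul p (qmul q r) = qmul (qmul p q) r.
Proof. qring. Qed.
Lemma qmul_qscal_l c p q : qmul (qscal c p) q = qscal c (qmul p q).
Proof. qring. Qed.
Lemma qmul_qscal_r c p q : qmul p (qscal c q) = qscal c (qmul p q).
Proof. qring. Qed.
Lemma qmul_qopp_l p q : qmul (qopp p) q = qopp (qmul p q).
Proof. qring. Qed.
Lemma qmul_qopp_r p q : qmul p (qopp q) = qopp (qmul p q).
Proof. qring. Qed.
Lemma qmul_qadd_l p q r : qmul (qadd p q) r = qadd (qmul p r) (qmul q r).
Proof. qring. Qed.
Lemma qmul_qadd_r p q r : qmul r (qadd p q) = qadd (qmul r p) (qmul r q).
Proof. qring. Qed.
Lemma qadd_swap p q r s : qadd (qadd p q) (qadd r s) = qadd (qadd p r) (qadd q s).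
Proof. qring. Qed.
Lemma mmul_assoc g h k : mmul g (mmul h k) = mmul (mmul g h) k.
Proof.
destruct g as [[? ?] [? ?]], h as [[? ?] [? ?]], k as [[? ?] [? ?]].
unfold mmul, m11, m12, m21, m22; cbn [fst snd].
apply (f_equal2 (@pair _ _)); apply (f_equal2 (@pair _ _));
  rewrite 2 qmul_qadd_r, 2 qmul_qadd_l, 4 qmul_assoc; apply qadd_swap.
Qed.
Lemma mmul_1l g : mmul (mdiag (qreal 1) (qreal 1)) g = g.
Proof. mring. Qed.
Lemma mmul_1r g : mmul g (mdiag (qreal 1) (qreal 1)) = g.
Proof. mring. Qed.
Lemma madj_mmul g h : madj (mmul g h) = mmul (madj h) (madj g).
Proof. mring. Qed.
Lemma madj_madj g : madj (madj g) = g.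
Proof. mring. Qed.
Lemma madj_mdiag p q : madj (mdiag p q) = mdiag (qconj p) (qconj q).
Proof. mring. Qed.
Lemma mmul_mopp_l g h : mmul (mopp g) h = mopp (mmul g h).
Proof. mring. Qed.

Ltac modE :=
  change (@plus quat_ModuleSpace) with qadd;
  change (@zero quat_ModuleSpace) with (qreal 0);
  change (@scal R_Ring quat_ModuleSpace) with qscal;
  change (@plus R_ModuleSpace) with Rplus;
  change (@zero R_ModuleSpace) with 0;
  change (@scal R_Ring R_ModuleSpace) with Rmult.

Lemma extd_1form (A : point -> vect -> quat) x v w :
  extd (fun y => quat_lin1 (A y)) x [v; w] =
  qadd (dirDq (fun y => A y w) v x) (qopp (dirDq (fun y => A y v) w x)).
Proof.
unfold extd, quat_lin1, lin1, lsum;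
  cbn [length seq map fold_right nth firstn skipn app pow].
modE; set (a := dirDq _ v x); set (b := dirDq _ w x); clearbody a b.
qring.
Qed.

Lemma wedgeH_11 {V} (a b : V -> quat) v w :
  wedgeH (quat_lin1 a) (quat_lin1 b) [v; w] =
  qadd (qmul (a v) (b w)) (qopp (qmul (a w) (b v))).
Proof.
unfold wedgeH, wedge, quat_lin1, lin1, lsum;
  cbn [unshuffles flat_map app map fold_right length pow].
modE; generalize (a v) (a w) (b v) (b w); qring.
Qed.

Lemma asd_half {V} (c : V -> quat) v w :
  asd c [v; w] =
  qscal (1 / 2) (wedgeH (quat_lin1 (fun u => qconj (c u))) (quat_lin1 c) [v; w]).
Proof.
rewrite wedgeH_11.
unfold asd, asd1, asd2, asd3, e0, e1, e2, e3, wedgeR, wedge, lin1, lsum;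
  cbn [unshuffles flat_map app map fold_right length pow].
modE; generalize (c v) (c w); intros; qext; qpair; field.
Qed.

Lemma dirD_aff (F : point -> R) (x v : point) (a b c : R) :
  (forall t : R, F (plus x (scal t v)) = a + (t * b + t * t * c)) ->
  dirD F v x = b.
Proof.
intros H; unfold dirD.
apply eq_trans with (Derive (fun t : R => a + (t * b + t * t * c)) 0).
{ apply Derive_ext; exact H. }
apply is_derive_unique; auto_derive; trivial; ring.
Qed.

Lemma dirDq_aff (F : point -> quat) (x v : point) (G0 G1 G2 : quat) :
  (forall t : R, F (plus x (scal t v)) =
     qadd G0 (qadd (qscal t G1) (qscal (t * t) G2))) ->
  dirDq F v x = G1.
Proof.
intros H; unfold dirDq.
rewrite (dirD_aff _ x v (q0 G0) (q0 G1) (q0 G2)),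
        (dirD_aff _ x v (q1 G0) (q1 G1) (q1 G2)),
        (dirD_aff _ x v (q2 G0) (q2 G1) (q2 G2)),
        (dirD_aff _ x v (q3 G0) (q3 G1) (q3 G2));
  try (intros t; rewrite H; reflexivity).
destruct G1 as [[[? ?] ?] ?]; reflexivity.
Qed.

Lemma total_lift x v : total x -> fst v = mmul (fst x) (maurer_cartan x v).
Proof.
intros [_ H]; unfold maurer_cartan; rewrite mmul_assoc, H, mmul_1l; reflexivity.
Qed.

Lemma maurer_cartan_shape x v : tangent x v ->
  madj (maurer_cartan x v) = mopp (maurer_cartan x v).
Proof. intros H; exact H. Qed.

Lemma maurer_cartan_eq x v w : total x -> tangent x v ->
  mmul (madj (fst v)) (fst w) =
  mopp (mmul (maurer_cartan x v) (maurer_cartan x w)).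
Proof.
intros Hx Hv; rewrite (total_lift x w Hx) at 1; rewrite (total_lift x v Hx) at 1.
rewrite madj_mmul, maurer_cartan_shape by assumption.
rewrite <- mmul_assoc, (mmul_assoc (madj (fst x))).
destruct Hx as [H _]; rewrite H, mmul_1l, mmul_mopp_l; reflexivity.
Qed.

Lemma point_moveE (x v : point) (t : R) :
  plus x (scal t v) =
  (((qadd (m11 (fst x)) (qscal t (m11 (fst v))),
     qadd (m12 (fst x)) (qscal t (m12 (fst v)))),
    (qadd (m21 (fst x)) (qscal t (m21 (fst v))),
     qadd (m22 (fst x)) (qscal t (m22 (fst v))))),
   qadd (snd x) (qscal t (snd v))).
Proof. reflexivity. Qed.

Lemma mc_12 (x v w : point) : forall t : R,
  m12 (maurer_cartan (plus x (scal t v)) w) =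
  qadd (m12 (maurer_cartan x w))
       (qadd (qscal t (m12 (mmul (madj (fst v)) (fst w)))) (qscal (t * t) (qreal 0))).
Proof.
intros t; rewrite point_moveE.
destruct x as [[[? ?] [? ?]] ?], v as [[[? ?] [? ?]] ?], w as [[[? ?] [? ?]] ?].
unfold maurer_cartan, mmul, madj, m11, m12, m21, m22; cbn [fst snd].
qring.
Qed.

Lemma mc_22 (x v w : point) : forall t : R,
  m22 (maurer_cartan (plus x (scal t v)) w) =
  qadd (m22 (maurer_cartan x w))
       (qadd (qscal t (m22 (mmul (madj (fst v)) (fst w)))) (qscal (t * t) (qreal 0))).
Proof.
intros t; rewrite point_moveE.
destruct x as [[[? ?] [? ?]] ?], v as [[[? ?] [? ?]] ?], w as [[[? ?] [? ?]] ?].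
unfold maurer_cartan, mmul, madj, m11, m12, m21, m22; cbn [fst snd].
qring.
Qed.

(* d omega = - xi /\ omega - omega /\ phi *)
Lemma structure_omega kappa x v w : total x -> tangent x v -> tangent x w ->
  extd (fun y => quat_lin1 (omega kappa y)) x [v; w] =
  qadd (qopp (wedgeH (quat_lin1 (xi x)) (quat_lin1 (omega kappa x)) [v; w]))
       (qopp (wedgeH (quat_lin1 (omega kappa x)) (quat_lin1 (phi x)) [v; w])).
Proof.
intros Hx Hv Hw; rewrite extd_1form, !wedgeH_11.
assert (E : forall v w, tangent x v ->
  dirDq (fun y => omega kappa y w) v x =
  qscal (2 / sqrt kappa) (m12 (mopp (mmul (maurer_cartan x v) (maurer_cartan x w))))).
{ intros v' w' Hv'; rewrite <- maurer_cartan_eq by assumption.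
  apply dirDq_aff with (G0 := omega kappa x w') (G2 := qreal 0); intros t.
  unfold omega; rewrite mc_12; generalize (2 / sqrt kappa).
  generalize (m12 (maurer_cartan x w')) (m12 (mmul (madj (fst v')) (fst w'))).
  clear; qring. }
rewrite !E by assumption; clear E.
unfold xi, phi, omega; generalize (2 / sqrt kappa); intros k.
generalize (maurer_cartan x v) (maurer_cartan x w); clear; intros g h.
destruct g as [[? ?] [? ?]], h as [[? ?] [? ?]].
unfold mmul, mopp, m11, m12, m21, m22; cbn [fst snd].
rewrite ?qmul_qscal_l, ?qmul_qscal_r.
repeat match goal with |- context [qmul ?a ?b] => generalize (qmul a b) end.
clear; qring.
Qed.

(* d phi + phi /\ phi = (kappa / 2) Omega *)
Lemma structure_phi kappa x v w : 0 < kappa ->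
  total x -> tangent x v -> tangent x w ->
  qadd (extd (fun y => quat_lin1 (phi y)) x [v; w])
       (wedgeH (quat_lin1 (phi x)) (quat_lin1 (phi x)) [v; w]) =
  qscal (kappa / 2) (asd (omega kappa x) [v; w]).
Proof.
intros Hk Hx Hv Hw; rewrite asd_half, extd_1form, !wedgeH_11.
assert (E : forall v w, tangent x v ->
  dirDq (fun y => phi y w) v x =
  m22 (mopp (mmul (maurer_cartan x v) (maurer_cartan x w)))).
{ intros v' w' Hv'; rewrite <- maurer_cartan_eq by assumption.
  apply dirDq_aff with (G0 := phi x w') (G2 := qreal 0); intros t.
  unfold phi; apply mc_22. }
rewrite !E by assumption; clear E.
apply maurer_cartan_shape in Hv; apply maurer_cartan_shape in Hw.
unfold phi, omega.
assert (S : 2 / sqrt kappa * (2 / sqrt kappa) * kappa = 4).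
{ rewrite <- (sqrt_sqrt kappa) at 3 by lra; field.
  apply Rgt_not_eq, sqrt_lt_R0, Hk. }
revert S Hv Hw; generalize (2 / sqrt kappa); intros k S.
generalize (maurer_cartan x v) (maurer_cartan x w); clear - S; intros g h Hg Hh.
apply (f_equal m21) in Hg; apply (f_equal m21) in Hh.
destruct g as [[? ?] [? ?]], h as [[? ?] [? ?]].
unfold mmul, madj, mopp, m11, m12, m21, m22 in *; cbn [fst snd] in *.
assert (N : forall a b, qconj a = qopp b -> b = qopp (qconj a)).
{ intros a b H; rewrite H; clear; qring. }
apply N in Hg; apply N in Hh; subst.
assert (K : forall a b : quat,
  qscal (kappa / 2) (qscal (1 / 2)
    (qadd (qmul (qconj (qscal k a)) (qscal k b))
          (qopp (qmul (qconj (qscal k b)) (qscal k a))))) =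
  qadd (qmul (qconj a) b) (qopp (qmul (qconj b) a))).
{ intros a b.
  replace (qmul (qconj (qscal k a)) (qscal k b))
    with (qscal (k * k) (qmul (qconj a) b)) by (clear; qring).
  replace (qmul (qconj (qscal k b)) (qscal k a))
    with (qscal (k * k) (qmul (qconj b) a)) by (clear; qring).
  set (X := qmul (qconj a) b); set (Y := qmul (qconj b) a); clearbody X Y.
  transitivity (qscal (k * k * kappa / 4) (qadd X (qopp Y))).
  - clear; qext; qpair; field.
  - rewrite S; clear; qext; qpair; field. }
rewrite K, ?qmul_qopp_l; clear.
repeat match goal with |- context [qmul ?a ?b] => generalize (qmul a b) end.
qring.
Qed.

(* The bundle projection F -> S^4, S^4 being the sphere of radius 1 / sqrt kappa
   in H + R. *)
Definition base_H (kappa : R) (x : point) : quat :=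
  qscal (2 / sqrt kappa) (qmul (m11 (fst x)) (qconj (m21 (fst x)))).
Definition base_R (kappa : R) (x : point) : R :=
  1 / sqrt kappa * (qnorm2 (m11 (fst x)) - qnorm2 (m21 (fst x))).

Lemma qnorm2_qmul p q : qnorm2 (qmul p q) = qnorm2 p * qnorm2 q.
Proof. intros; qext; ring. Qed.
Lemma qnorm2_qconj p : qnorm2 (qconj p) = qnorm2 p.
Proof. intros; qext; ring. Qed.
Lemma qnorm2_qscal c p : qnorm2 (qscal c p) = c * c * qnorm2 p.
Proof. intros; qext; ring. Qed.
Lemma qnorm2_qadd p q : qnorm2 (qadd p q) = qnorm2 p + qnorm2 q + 2 * q0 (qmul p (qconj q)).
Proof. intros; qext; ring. Qed.
Lemma qnorm2_ge0 p : 0 <= qnorm2 p.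
Proof. qext; nra. Qed.
Lemma qnorm2_eq0 p : qnorm2 p = 0 -> p = qreal 0.
Proof. intros; qext; repeat apply (f_equal2 (@pair _ _)); nra. Qed.
Lemma qmul_qconj_r p : qmul p (qconj p) = qreal (qnorm2 p).
Proof. qring. Qed.
Lemma qmul_qconj_l p : qmul (qconj p) p = qreal (qnorm2 p).
Proof. qring. Qed.
Lemma qconj_qmul p q : qconj (qmul p q) = qmul (qconj q) (qconj p).
Proof. qring. Qed.
Lemma qmul_qreal_l c p : qmul (qreal c) p = qscal c p.
Proof. qring. Qed.
Lemma qmul_qreal_r c p : qmul p (qreal c) = qscal c p.
Proof. qring. Qed.
Lemma qadd_qreal c d : qadd (qreal c) (qreal d) = qreal (c + d).
Proof. qring. Qed.
Lemma qreal_inj c d : qreal c = qreal d -> c = d.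
Proof. intros H; apply (f_equal q0) in H; exact H. Qed.
Lemma SU2_norm p : SU2 p <-> qnorm2 p = 1.
Proof.
unfold SU2; rewrite qmul_qconj_l; split; [apply qreal_inj | congruence].
Qed.

Lemma Sp2_norms g : Sp2 g ->
  (qnorm2 (m11 g) + qnorm2 (m21 g) = 1 /\
   qnorm2 (m12 g) + qnorm2 (m22 g) = 1) /\
  (qnorm2 (m11 g) + qnorm2 (m12 g) = 1 /\
   qnorm2 (m21 g) + qnorm2 (m22 g) = 1) /\
  qadd (qmul (qconj (m11 g)) (m12 g)) (qmul (qconj (m21 g)) (m22 g)) = qreal 0.
Proof.
intros [H1 H2]; destruct g as [[a b] [c d]].
unfold mmul, madj, mdiag, m11, m12, m21, m22 in *; cbn [fst snd] in *.
rewrite !qmul_qconj_l in H1; rewrite !qmul_qconj_r in H2.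
rewrite !qadd_qreal in H1, H2.
assert (P : forall (A B : Type) (x y : A) (z t : B), (x, z) = (y, t) -> x = y /\ z = t)
  by (intros A B x y z t E; injection E; auto).
apply P in H1; destruct H1 as [H1 H1']; apply P in H1, H1'.
apply P in H2; destruct H2 as [H2 H2']; apply P in H2, H2'.
repeat split; try apply qreal_inj; tauto.
Qed.

Lemma base_sphere kappa x : 0 < kappa -> total x ->
  qnorm2 (base_H kappa x) + base_R kappa x ^ 2 = 1 / kappa.
Proof.
intros Hk Hx; destruct (Sp2_norms _ Hx) as [[H1 _] _].
unfold base_H, base_R; rewrite qnorm2_qscal, qnorm2_qmul, qnorm2_qconj.
assert (Hs : sqrt kappa <> 0) by apply Rgt_not_eq, sqrt_lt_R0, Hk.
rewrite <- (sqrt_sqrt kappa) at 4 by lra.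
replace (qnorm2 (m11 (fst x))) with (1 - qnorm2 (m21 (fst x))) by lra.
field; exact Hs.
Qed.

Lemma Sp2_mmul g h : Sp2 g -> Sp2 h -> Sp2 (mmul g h).
Proof.
intros [G1 G2] [H1 H2]; split; rewrite madj_mmul.
- rewrite <- mmul_assoc, (mmul_assoc (madj g)), G1, mmul_1l; exact H1.
- rewrite <- mmul_assoc, (mmul_assoc h), H2, mmul_1l; exact G2.
Qed.
Lemma Sp2_madj g : Sp2 g -> Sp2 (madj g).
Proof. intros [G1 G2]; split; rewrite madj_madj; assumption. Qed.

(* The fibres of the projection are the Spin(4)-orbits. *)
Lemma base_orbits kappa x y : 0 < kappa -> total x -> total y ->
  (base_H kappa x = base_H kappa y /\ base_R kappa x = base_R kappa y <->
   exists p q, SU2 p /\ SU2 q /\ fst y = mmul (fst x) (mdiag p q)).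
Proof.
intros Hk Hx Hy.
assert (Hs : 0 < / sqrt kappa) by apply Rinv_0_lt_compat, sqrt_lt_R0, Hk.
unfold base_H, base_R, Rdiv; revert Hs; generalize (/ sqrt kappa); intros k Hs.
unfold total in *; revert Hx Hy; generalize (fst x) (fst y); clear x y Hk.
intros g h Hg Hh; split.
- intros [E1 E2].
  assert (E1' : qmul (m11 g) (qconj (m21 g)) = qmul (m11 h) (qconj (m21 h))).
  { revert E1; generalize (qmul (m11 g) (qconj (m21 g))) (qmul (m11 h) (qconj (m21 h))).
    clear - Hs; intros a b E.
    assert (E' : qscal (/ (2 * k)) (qscal (2 * k) a) = qscal (/ (2 * k)) (qscal (2 * k) b))
      by congruence.
    assert (I : forall c, qscal (/ (2 * k)) (qscal (2 * k) c) = c)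
      by (intros; qext; qpair; field; lra).
    rewrite !I in E'; exact E'. }
  assert (E2' : qnorm2 (m11 g) - qnorm2 (m21 g) = qnorm2 (m11 h) - qnorm2 (m21 h)) by nra.
  destruct (Sp2_norms _ Hg) as [[N1 _] _]; destruct (Sp2_norms _ Hh) as [[N2 _] _].
  pose proof (Sp2_mmul _ _ (Sp2_madj _ Hg) Hh) as Hm.
  assert (EN : qnorm2 (m11 (mmul (madj g) h)) = 1).
  { assert (Ea : qnorm2 (m11 h) = qnorm2 (m11 g)) by lra.
    assert (Eb : qnorm2 (m21 h) = qnorm2 (m21 g)) by lra.
    replace (m11 (mmul (madj g) h)) with
      (qadd (qmul (qconj (m11 g)) (m11 h)) (qmul (qconj (m21 g)) (m21 h)))
      by (destruct g as [[? ?] [? ?]], h as [[? ?] [? ?]]; reflexivity).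
    rewrite qnorm2_qadd, !qnorm2_qmul, !qnorm2_qconj, Ea, Eb, qconj_qmul.
    replace (qmul (qmul (qconj (m11 g)) (m11 h))
               (qmul (qconj (m21 h)) (qconj (qconj (m21 g)))))
      with (qmul (qmul (qconj (m11 g)) (qmul (m11 h) (qconj (m21 h)))) (m21 g))
      by (rewrite !qmul_assoc; f_equal; clear; generalize (m21 g); qring).
    rewrite <- E1', qmul_assoc, qmul_qconj_l, qmul_qreal_l, qmul_qscal_l,
      qmul_qconj_l.
    unfold qscal, qreal, q0; cbn [fst snd].
    replace (qnorm2 (m11 g)) with (1 - qnorm2 (m21 g)) by lra; ring. }
  destruct (Sp2_norms _ Hm) as [[M1 M2] [[M3 M4] _]].
  assert (Z1 : m12 (mmul (madj g) h) = qreal 0) by (apply qnorm2_eq0; lra).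
  assert (Z2 : m21 (mmul (madj g) h) = qreal 0) by (apply qnorm2_eq0; lra).
  exists (m11 (mmul (madj g) h)), (m22 (mmul (madj g) h)).
  rewrite !SU2_norm; split; [lra | split].
  + assert (Q : qnorm2 (m12 (mmul (madj g) h)) = 0)
      by (rewrite Z1; unfold qnorm2, qreal, q0, q1, q2, q3; cbn [fst snd]; ring).
    lra.
  + transitivity (mmul g (mmul (madj g) h)).
    * rewrite mmul_assoc; destruct Hg as [_ ->]; symmetry; apply mmul_1l.
    * f_equal; revert Z1 Z2; generalize (mmul (madj g) h); intros [[? ?] [? ?]].
      unfold mdiag, m11, m12, m21, m22; cbn [fst snd]; intros -> ->; reflexivity.
- intros (p & q & Hp & Hq & ->).
  assert (E1 : m11 (mmul g (mdiag p q)) = qmul (m11 g) p)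
    by (destruct g as [[? ?] [? ?]]; unfold mmul, mdiag, m11, m12, m21, m22;
        cbn [fst snd]; qring).
  assert (E2 : m21 (mmul g (mdiag p q)) = qmul (m21 g) p)
    by (destruct g as [[? ?] [? ?]]; unfold mmul, mdiag, m11, m12, m21, m22;
        cbn [fst snd]; qring).
  rewrite SU2_norm in Hp.
  rewrite E1, E2, !qnorm2_qmul, Hp, !Rmult_1_r; split; [| reflexivity].
  f_equal; rewrite qconj_qmul, <- qmul_assoc, (qmul_assoc p), qmul_qconj_r, Hp, qmul_qreal_l.
  f_equal; clear; generalize (m21 g); qring.
Qed.

Lemma base_surjective kappa z t : 0 < kappa -> qnorm2 z + t ^ 2 = 1 / kappa ->
  exists x, total x /\ base_H kappa x = z /\ base_R kappa x = t.
Proof.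
intros Hk H.
assert (Hs : 0 < sqrt kappa) by apply sqrt_lt_R0, Hk.
assert (H' : qnorm2 (qscal (sqrt kappa) z) + (sqrt kappa * t) ^ 2 = 1).
{ rewrite qnorm2_qscal, sqrt_sqrt by lra.
  replace ((sqrt kappa * t) ^ 2) with (sqrt kappa * sqrt kappa * t ^ 2) by ring.
  rewrite sqrt_sqrt by lra.
  replace (kappa * qnorm2 z + kappa * t ^ 2) with (kappa * (qnorm2 z + t ^ 2)) by ring.
  rewrite H; field; lra. }
assert (Ez : z = qscal (1 / sqrt kappa) (qscal (sqrt kappa) z))
  by (clear - Hs; qext; qpair; field; lra).
assert (Et : t = 1 / sqrt kappa * (sqrt kappa * t)) by (field; lra).
unfold base_H, base_R; rewrite Ez, Et.
revert H'; generalize (qscal (sqrt kappa) z) (sqrt kappa * t).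
intros Z T HT.
assert (Hn := qnorm2_ge0 Z).
assert (E2 : forall X, qscal (2 / sqrt kappa) X = qscal (1 / sqrt kappa) (qscal 2 X))
  by (clear - Hs; intros X; qext; qpair; field; lra).
assert (G : exists g, Sp2 g /\ qscal 2 (qmul (m11 g) (qconj (m21 g))) = Z /\
                      qnorm2 (m11 g) - qnorm2 (m21 g) = T).
{ destruct (Req_dec T (-1)) as [-> | Hne].
  - assert (HZ : Z = qreal 0) by (apply qnorm2_eq0; lra); subst Z.
    exists ((qreal 0, qreal (-1)), (qreal 1, qreal 0)).
    unfold Sp2, mmul, madj, mdiag, m11, m12, m21, m22; cbn [fst snd].
    repeat split; repeat apply (f_equal2 (@pair _ _)); qext; try qpair; ring.
  - assert (HT1 : 0 < (1 + T) / 2) by nra.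
    set (c := sqrt ((1 + T) / 2)).
    assert (Hc : c * c = (1 + T) / 2) by (apply sqrt_sqrt; lra).
    assert (Hc0 : 0 < c) by (apply sqrt_lt_R0; exact HT1).
    assert (HZ : qnorm2 (qscal (/ (2 * c)) Z) = (1 - T) / 2).
    { rewrite qnorm2_qscal.
      replace (qnorm2 Z) with (1 - T ^ 2) by lra.
      replace (/ (2 * c) * / (2 * c)) with (/ (4 * (c * c))) by (field; lra).
      rewrite Hc; field; lra. }
    assert (HZ2 : Z = qscal (2 * c) (qscal (/ (2 * c)) Z))
      by (clear - Hc0; qext; qpair; field; lra).
    rewrite HZ2; revert HZ; generalize (qscal (/ (2 * c)) Z); intros W HW.
    exists ((qreal c, qopp W), (qconj W, qreal c)).
    unfold Sp2, mmul, madj, mdiag, m11, m12, m21, m22; cbn [fst snd].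
    clear - HW Hc; unfold qnorm2 in HW; repeat split;
      repeat apply (f_equal2 (@pair _ _)); qext; try qpair; nra. }
destruct G as [g [Hg [G1 G2]]].
exists (g, qreal 0); unfold total; cbn [fst snd].
rewrite E2, G1, G2; auto.
Qed.

Lemma m11_move (x v : point) (t : R) :
  m11 (fst (plus x (scal t v))) = qadd (m11 (fst x)) (qscal t (m11 (fst v))).
Proof. reflexivity. Qed.
Lemma m21_move (x v : point) (t : R) :
  m21 (fst (plus x (scal t v))) = qadd (m21 (fst x)) (qscal t (m21 (fst v))).
Proof. reflexivity. Qed.
Lemma qconj_qadd p q : qconj (qadd p q) = qadd (qconj p) (qconj q).
Proof. qring. Qed.
Lemma qconj_qscal c p : qconj (qscal c p) = qscal c (qconj p).
Proof. qring. Qed.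
Lemma qconj_qopp p : qconj (qopp p) = qopp (qconj p).
Proof. qring. Qed.
Ltac qlin :=
  rewrite ?qmul_qadd_l, ?qmul_qadd_r, ?qmul_qscal_l, ?qmul_qscal_r,
    ?qmul_qopp_l, ?qmul_qopp_r;
  repeat match goal with |- context [qmul ?a ?b] => generalize (qmul a b) end;
  clear; qring.

(* omega at u is an isometry from T S^4 onto H: u is a coframe. *)
Lemma omega_isometry kappa x v : 0 < kappa -> total x -> tangent x v ->
  qnorm2 (dirDq (base_H kappa) v x) + dirD (base_R kappa) v x ^ 2 =
  qnorm2 (omega kappa x v).
Proof.
intros Hk Hx Hv.
assert (Hs : sqrt kappa <> 0) by apply Rgt_not_eq, sqrt_lt_R0, Hk.
assert (E1 : dirDq (base_H kappa) v x =
  qscal (2 / sqrt kappa)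
    (qadd (qmul (m11 (fst v)) (qconj (m21 (fst x))))
          (qmul (m11 (fst x)) (qconj (m21 (fst v)))))).
{ apply dirDq_aff with (G0 := base_H kappa x)
    (G2 := qscal (2 / sqrt kappa) (qmul (m11 (fst v)) (qconj (m21 (fst v))))).
  intros t; unfold base_H; rewrite m11_move, m21_move.
  generalize (2 / sqrt kappa) (m11 (fst x)) (m11 (fst v)) (m21 (fst x)) (m21 (fst v)).
  clear; intros; rewrite qconj_qadd, qconj_qscal.
  rewrite !qmul_qadd_l, !qmul_qadd_r, !qmul_qscal_l, !qmul_qscal_r; qlin. }
assert (E2 : dirD (base_R kappa) v x =
  2 / sqrt kappa * (qdot (m11 (fst x)) (m11 (fst v)) - qdot (m21 (fst x)) (m21 (fst v)))).
{ apply dirD_aff with (a := base_R kappa x)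
    (c := 1 / sqrt kappa * (qnorm2 (m11 (fst v)) - qnorm2 (m21 (fst v)))).
  intros t; unfold base_R; rewrite m11_move, m21_move.
  replace (2 / sqrt kappa) with (2 * (1 / sqrt kappa)) by (field; exact Hs).
  generalize (1 / sqrt kappa) (m11 (fst x)) (m11 (fst v)) (m21 (fst x)) (m21 (fst v)).
  clear; intros; unfold qdot; qext; ring. }
rewrite E1, E2; clear E1 E2.
unfold omega; rewrite !qnorm2_qscal, Rpow_mult_distr.
replace ((2 / sqrt kappa) ^ 2) with (2 / sqrt kappa * (2 / sqrt kappa)) by ring.
rewrite <- Rmult_plus_distr_l; f_equal.
pose proof (total_lift x v Hx) as L.
apply maurer_cartan_shape in Hv.
destruct (Sp2_norms _ Hx) as [[N1 N2] [[N3 N4] N5]].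
revert L Hv N1 N2 N3 N4 N5.
generalize (fst v) (maurer_cartan x v) (fst x); clear; intros w h g -> Hh.
destruct g as [[a b] [c d]], h as [[xi0 z] [y phi0]].
pose proof (f_equal (fun m => q0 (m11 m)) Hh) as H0.
apply (f_equal m21) in Hh.
unfold mmul, madj, mopp, m11, m12, m21, m22 in *; cbn [fst snd] in *.
assert (Hy : y = qopp (qconj z)) by (rewrite Hh; clear; qring); subst y; clear Hh.
assert (Hxi : qconj xi0 = qopp xi0).
{ clear - H0; qext; qpair; lra. }
intros N1 N2 N3 N4 N5.
assert (N5' : qmul (qconj c) d = qopp (qmul (qconj a) b)).
{ revert N5; generalize (qmul (qconj a) b) (qmul (qconj c) d); clear; intros p q H.
  transitivity (qadd (qopp p) (qadd p q)); [qring | rewrite H; qring]. }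
set (u := q0 (qmul (qmul (qconj a) b) (qconj z))).
assert (X : qadd (qmul (qadd (qmul a xi0) (qmul b (qopp (qconj z)))) (qconj c))
                 (qmul a (qconj (qadd (qmul c xi0) (qmul d (qopp (qconj z)))))) =
            qopp (qadd (qmul (qmul b (qconj z)) (qconj c)) (qmul (qmul a z) (qconj d)))).
{ rewrite qconj_qadd, !qconj_qmul, qconj_qopp, Hxi.
  replace (qconj (qconj z)) with z by (clear; qring).
  rewrite ?qmul_qadd_l, ?qmul_qadd_r, ?qmul_qopp_r, ?qmul_qopp_l, ?qmul_qopp_r,
    ?qmul_assoc.
  qlin. }
assert (D : forall p q, qdot p (qadd (qmul p xi0) (qmul q (qopp (qconj z)))) =
                        - q0 (qmul (qmul (qconj p) q) (qconj z))).
{ clear - H0; intros p q; unfold qdot; qext.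
  match type of H0 with ?r = _ => replace r with 0 by lra end; ring. }
rewrite X, !D, N5', qmul_qopp_l; clear X D.
assert (Nopp : forall p, qnorm2 (qopp p) = qnorm2 p) by (clear; intros; qext; ring).
rewrite Nopp; clear Nopp.
rewrite qnorm2_qadd, !qnorm2_qmul, !qnorm2_qconj.
replace (qconj (qmul (qmul a z) (qconj d))) with (qmul (qmul d (qconj z)) (qconj a))
  by (rewrite !qconj_qmul, !qmul_assoc; f_equal; f_equal; clear; generalize d; qring).
set (P := qmul (qmul (qconj a) b) (qconj z)).
assert (HP : qnorm2 P = qnorm2 a * qnorm2 b * qnorm2 z)
  by (unfold P; rewrite !qnorm2_qmul, !qnorm2_qconj; ring).
assert (C : q0 (qmul (qmul (qmul b (qconj z)) (qconj c)) (qmul (qmul d (qconj z)) (qconj a)))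
            = - q0 (qmul P P)).
{ replace (qmul (qmul (qmul b (qconj z)) (qconj c)) (qmul (qmul d (qconj z)) (qconj a)))
    with (qmul (qmul (qmul b (qconj z)) (qmul (qmul (qconj c) d) (qconj z))) (qconj a))
    by (rewrite !qmul_assoc; reflexivity).
  rewrite N5', ?qmul_qopp_l, ?qmul_qopp_r, ?qmul_qopp_l.
  fold P.
  assert (T : forall p q, q0 (qmul p q) = q0 (qmul q p))
    by (clear; intros; qext; ring).
  change (- q0 (qmul (qmul (qmul b (qconj z)) P) (qconj a)) = - q0 (qmul P P)).
  rewrite T; unfold P at 2; rewrite !qmul_assoc; reflexivity. }
rewrite C; clear C.
assert (S : q0 (qmul P P) = 2 * q0 P * q0 P - qnorm2 P)
  by (clear; generalize P; intros; qext; ring).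
change (q0 (qopp P)) with (- q0 P).
rewrite S, HP.
replace (qnorm2 c) with (qnorm2 b) by lra.
replace (qnorm2 d) with (qnorm2 a) by lra.
replace (qnorm2 b) with (1 - qnorm2 a) by lra.
ring.
Qed.

Lemma omega_equivariant kappa x v p q :
  omega kappa (act p q x) (act p q v) = qmul (qmul (qconj p) (omega kappa x v)) q.
Proof.
unfold omega, act, maurer_cartan; cbn [fst snd].
rewrite madj_mmul, <- mmul_assoc, (mmul_assoc (madj (fst x))), madj_mdiag.
generalize (mmul (madj (fst x)) (fst v)) (2 / sqrt kappa); clear.
intros [[? ?] [? ?]] k; unfold mmul, mdiag, m11, m12, m21, m22; cbn [fst snd].
rewrite ?qmul_qreal_l, ?qmul_qreal_r, ?qmul_qadd_r, ?qmul_qscal_r, ?qmul_qscal_l, ?qmul_assoc.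
qlin.
Qed.

(* Spin(4) acts on coframes through its quotient SO(4). *)
Lemma coframe_kernel p q : SU2 p -> SU2 q ->
  ((forall h, qmul (qmul (qconj p) h) q = h) <->
   p = qreal 1 /\ q = qreal 1 \/ p = qreal (-1) /\ q = qreal (-1)).
Proof.
intros Hp Hq; split.
- intros H; rewrite SU2_norm in Hp.
  assert (E : qmul (qconj p) q = qreal 1).
  { rewrite <- (H (qreal 1)), qmul_qreal_r; f_equal; clear; qring. }
  assert (Eq : q = p).
  { transitivity (qmul p (qmul (qconj p) q)).
    - rewrite qmul_assoc, qmul_qconj_r, Hp; clear; qring.
    - rewrite E; clear; qring. }
  subst q.
  assert (C : forall h, qmul h p = qmul p h).
  { intros h; rewrite <- (H h) at 2.
    rewrite !qmul_assoc, qmul_qconj_r, Hp, qmul_qreal_l; f_equal; clear; qring. }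
  pose proof (C (0, 1, 0, 0)) as C1; pose proof (C (0, 0, 1, 0)) as C2.
  clear H C E Hq; qext.
  injection C1; injection C2; intros.
  match type of Hp with ?a * _ + ?b * _ + ?c * _ + ?d * _ = _ =>
    assert (b = 0) by lra; assert (c = 0) by lra; assert (d = 0) by lra;
    assert (K : (a - 1) * (a + 1) = 0) by (subst; lra)
  end.
  apply Rmult_integral in K; destruct K; [left | right]; split; qpair; lra.
- intros [[-> ->] | [-> ->]] h; qring.
Qed.

Lemma horizontal_lift kappa x a b : 0 < kappa -> total x ->
  exists v, tangent x v /\ alpha x v = a /\ omega kappa x v = b.
Proof.
intros Hk [H1 H2].
set (t := ((qreal 0, qscal (sqrt kappa / 2) b),
           (qscal (- (sqrt kappa / 2)) (qconj b), qreal 0)) : mat2).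
assert (M : mmul (madj (fst x)) (mmul (fst x) t) = t)
  by (rewrite mmul_assoc, H1; apply mmul_1l).
exists (mmul (fst x) t, a).
unfold tangent, alpha, omega, phi, maurer_cartan; cbn [fst snd].
rewrite !M; unfold t; clear - Hk.
split; [| split].
- unfold madj, mopp, m11, m12, m21, m22; cbn [fst snd].
  generalize (sqrt kappa / 2); clear; intros k.
  repeat apply (f_equal2 (@pair _ _)); qring.
- unfold m22; cbn [fst snd]; generalize (fibre x); qring.
- unfold m12; cbn [fst snd].
  assert (Hs : sqrt kappa <> 0) by apply Rgt_not_eq, sqrt_lt_R0, Hk.
  clear - Hs; qext; qpair; field; exact Hs.
Qed.

(** * The cases D = 0 and D < 0 *)

Lemma quat_eq a b :
  q0 a = q0 b -> q1 a = q1 b -> q2 a = q2 b -> q3 a = q3 b -> a = b.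
Proof. intros; qext; subst; reflexivity. Qed.

Lemma radius2E x : radius2 x = qnorm2 (fibre x).
Proof. unfold radius2; rewrite qmul_qconj_r; reflexivity. Qed.

Lemma flat_identity (a v w : quat) (c k1 k : R) : k1 = k * k * qnorm2 a ->
  qadd
    (qadd
      (qadd (qreal c) (qim (qadd (qscal k1 (qmul (qconj v) w))
         (qscal (- (2 * qdot a v) * k ^ 2) (qmul (qconj a) w)))))
      (qopp (qadd (qreal c) (qim (qadd (qscal k1 (qmul (qconj w) v))
         (qscal (- (2 * qdot a w) * k ^ 2) (qmul (qconj a) v)))))))
    (qadd
      (qmul (qscal k (qim (qmul (qconj a) v))) (qscal k (qim (qmul (qconj a) w))))
      (qopp (qmul (qscal k (qim (qmul (qconj a) w))) (qscal k (qim (qmul (qconj a) v))))))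
  = qreal 0.
Proof. intros ->; unfold qdot; qext; qpair; ring. Qed.

(* For D = 0 the connection is flat: it is the pull-back of the Maurer-Cartan
   form of SU(2) by a / |a|. *)
Lemma flat_D0 : is_flat (domain 0) (Aconn 0).
Proof.
assert (F0 : forall r, f 0 r = / r).
{ intros r; unfold f; rewrite !Rmult_0_l, Rplus_0_r, Rmult_1_r; unfold Rdiv; ring. }
assert (AE : forall y w, Aconn 0 y w =
  qadd (phi y w) (qscal (/ qnorm2 (fibre y))
    (qim (qadd (qmul (qconj (fibre y)) (snd w))
               (qopp (qscal (qnorm2 (fibre y)) (phi y w))))))).
{ intros y w; unfold Aconn, A2, alpha; rewrite F0, radius2E.
  rewrite qmul_qadd_r, qmul_qopp_r, qmul_assoc, qmul_qconj_l, qmul_qreal_l; reflexivity. }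
assert (DS : forall (n m l p0 p1 u0 u1 : R), n <> 0 ->
  Derive (fun t : R => (p0 + (t * p1 + t * t * 0)) + / (n + (t * m + t * t * l)) *
    ((u0 + t * u1) + - ((n + (t * m + t * t * l)) * (p0 + (t * p1 + t * t * 0))))) 0 =
  u1 / n - m * u0 / n ^ 2).
{ intros n m l p0 p1 u0 u1 Hn; apply is_derive_unique; auto_derive.
  - rewrite !Rmult_0_l, !Rplus_0_r; exact Hn.
  - field; exact Hn. }
assert (DA : forall x v w, qnorm2 (fibre x) <> 0 ->
  dirDq (fun y => Aconn 0 y w) v x =
  qadd (qreal (q0 (m22 (mmul (madj (fst v)) (fst w)))))
    (qim (qadd (qscal (/ qnorm2 (fibre x)) (qmul (qconj (snd v)) (snd w)))
       (qscal (- (2 * qdot (fibre x) (snd v)) / qnorm2 (fibre x) ^ 2)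
          (qmul (qconj (fibre x)) (snd w)))))).
{ intros x v w Hn.
  assert (E : forall t : R, Aconn 0 (plus x (scal t v)) w =
    let N := qnorm2 (fibre x) + (t * (2 * qdot (fibre x) (snd v))
               + t * t * qnorm2 (snd v)) in
    let p := qadd (phi x w) (qadd (qscal t (m22 (mmul (madj (fst v)) (fst w))))
               (qscal (t * t) (qreal 0))) in
    qadd p (qscal (/ N) (qim (qadd (qadd (qmul (qconj (fibre x)) (snd w))
                                (qscal t (qmul (qconj (snd v)) (snd w))))
                              (qopp (qscal N p)))))).
  { intros t; rewrite AE; cbv zeta; unfold phi; rewrite mc_22.
    change (fibre (plus x (scal t v))) with (qadd (fibre x) (qscal t (snd v))).
    replace (qnorm2 (qadd (fibre x) (qscal t (snd v)))) with
      (qnorm2 (fibre x) + (t * (2 * qdot (fibre x) (snd v)) + t * t * qnorm2 (snd v)))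
      by (generalize (fibre x) (snd v); clear; intros; unfold qdot; qext; ring).
    do 4 f_equal.
    rewrite qconj_qadd, qconj_qscal, qmul_qadd_l, qmul_qscal_l; reflexivity. }
  cbv zeta in E.
  revert E Hn; generalize (m22 (mmul (madj (fst v)) (fst w))) (phi x w)
    (qmul (qconj (fibre x)) (snd w)) (qmul (qconj (snd v)) (snd w))
    (qnorm2 (fibre x)) (2 * qdot (fibre x) (snd v)) (qnorm2 (snd v)).
  intros P p u0 u1 n m l E Hn.
  apply quat_eq.
  - apply eq_trans with (Derive (fun t : R => q0 p + (t * q0 P + t * t * 0)) 0).
    + apply Derive_ext; intros t; refine (eq_trans (f_equal q0 (E t)) _).
      change (q0 p + (t * q0 P + t * t * 0) + / (n + (t * m + t * t * l)) * 0 =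
              q0 p + (t * q0 P + t * t * 0)); ring.
    + clear; apply is_derive_unique; auto_derive; trivial; qext; ring.
  - apply eq_trans with (Derive (fun t : R => (q1 p + (t * q1 P + t * t * 0)) +
      / (n + (t * m + t * t * l)) * ((q1 u0 + t * q1 u1) +
        - ((n + (t * m + t * t * l)) * (q1 p + (t * q1 P + t * t * 0))))) 0).
    + apply Derive_ext; intros t; exact (f_equal q1 (E t)).
    + rewrite DS by exact Hn; clear - Hn; qext; field; exact Hn.
  - apply eq_trans with (Derive (fun t : R => (q2 p + (t * q2 P + t * t * 0)) +
      / (n + (t * m + t * t * l)) * ((q2 u0 + t * q2 u1) +
        - ((n + (t * m + t * t * l)) * (q2 p + (t * q2 P + t * t * 0))))) 0).
    + apply Derive_ext; intros t; exact (f_equal q2 (E t)).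
    + rewrite DS by exact Hn; clear - Hn; qext; field; exact Hn.
  - apply eq_trans with (Derive (fun t : R => (q3 p + (t * q3 P + t * t * 0)) +
      / (n + (t * m + t * t * l)) * ((q3 u0 + t * q3 u1) +
        - ((n + (t * m + t * t * l)) * (q3 p + (t * q3 P + t * t * 0))))) 0).
    + apply Derive_ext; intros t; exact (f_equal q3 (E t)).
    + rewrite DS by exact Hn; clear - Hn; qext; field; exact Hn. }
assert (AT : forall x v, qnorm2 (fibre x) <> 0 -> tangent x v ->
  Aconn 0 x v = qscal (/ qnorm2 (fibre x)) (qim (qmul (qconj (fibre x)) (snd v)))).
{ intros x v Hn Hv; rewrite AE.
  assert (Z : q0 (phi x v) = 0).
  { apply (f_equal (fun m => q0 (m22 m))) in Hv; revert Hv.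
    change (phi x v) with (m22 (mmul (madj (fst x)) (fst v))).
    generalize (mmul (madj (fst x)) (fst v)); intros [[? ?] [? ?]].
    unfold madj, mopp, m22; cbn [fst snd]; intros; qext; lra. }
  revert Hn Z; generalize (phi x v) (qmul (qconj (fibre x)) (snd v)) (qnorm2 (fibre x)).
  clear; intros p u n Hn Z; qext; qpair; [rewrite Z; ring | | |]; field; exact Hn. }
intros x v w _ [Hr _] Hv Hw.
unfold off_zero_section in Hr; rewrite radius2E in Hr.
unfold curvature; rewrite extd_1form, wedgeH_11, !DA, !AT by assumption.
assert (S : q0 (m22 (mmul (madj (fst v)) (fst w))) = q0 (m22 (mmul (madj (fst w)) (fst v)))).
{ destruct v as [[[? ?] [? ?]] ?], w as [[[? ?] [? ?]] ?].
  unfold mmul, madj, m11, m12, m21, m22; cbn [fst snd]; qext; ring. }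
rewrite S; clear - Hr.
unfold Rdiv; rewrite <- pow_inv.
apply flat_identity; field; exact Hr.
Qed.

Lemma domain_nonneg D x : 0 <= D -> (domain D x <-> off_zero_section x).
Proof.
intros HD; unfold domain; split; [tauto |]; intros H; split; [exact H |].
pose proof (exp_pos (3 / 5 * ln (1 + radius2 x))); unfold Rpower; nra.
Qed.

Lemma domain_neg D : -1 < D < 0 ->
  exists r, 0 < r /\ 1 + D * Rpower (1 + r) (3 / 5) = 0.
Proof.
intros HD; exists (Rpower (/ - D) (5 / 3) - 1).
assert (H1 : 1 < / - D) by (rewrite <- Rinv_1; apply Rinv_lt_contravar; lra).
split.
- assert (H := Rpower_lt (/ - D) 0 (5 / 3) H1 ltac:(lra)).
  rewrite Rpower_O in H by lra; lra.
- replace (1 + (Rpower (/ - D) (5 / 3) - 1)) with (Rpower (/ - D) (5 / 3)) by ring.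
  rewrite Rpower_mult; replace (5 / 3 * (3 / 5)) with 1 by field.
  rewrite Rpower_1 by lra; field; lra.
Qed.

(* Main.v *)
From Stdlib Require Import Reals List Lra Lia FunctionalExtensionality.
From Coquelicot Require Import Coquelicot.
Require Import Defs.
Import ListNotations.
Open Scope R_scope.

(* The structure equations give, for A = phi + h(r) A_2,

     F_A = (kappa/2) (1 - r h) Omega + (2 h + r h' - r h^2) B
           + (h' + h^2) conj(a) S a,

   where S is the self-dual counterpart of B.  The forms
   tau Omega^i + sigma B^i and the self-dual forms in the alpha^j solve
   *(Psi /\ F) = F, so A is an instanton as soon as the coefficients of Omega
   and B are in the ratio tau : sigma.  This is the Riccati equation
   r h' = r h^2 - 2 h + (2/5) (1 - r h) / (1 + r), which f satisfies; and
   1 - r f = 3 D s r / (5 (1 + r) (1 + D s)) with s = (1 + r)^(3/5), so the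
   Omega-component of F_A does not vanish when D <> 0.

   For the Hodge star, let e_1, ..., e_8 be an oriented orthonormal frame, with
   dual coframe e^i.  Then (Psi /\ F)(e_1, ..., e_6) is the value on the frame of
   Psi /\ F /\ e^7 /\ e^8, a multiple of the volume form which is computed in the
   exterior algebra on the alpha^i and omega^i; the volume form is 1 on the
   frame because a Gram determinant is a square. *)

(** * The exterior algebra *)

Section Exterior.
Context {V : Type}.
Implicit Types (a b c : alt V R) (u v w : V) (vs ws : list V) (l : V -> R).

(** Elements of [alt V R] are arbitrary functions on lists, neither multilinear nor alternating; the
    identities below are proved by induction on the list of vectors alone. *)
Definition contract v a : alt V R := fun vs => a (v :: vs).
Definition grade a : alt V R := fun vs => (-1) ^ length vs * a vs.
Definition zeroA : alt V R := fun _ => 0.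
Definition oneA : alt V R := fun vs => match vs with [] => 1 | _ => 0 end.
Definition addA a b : alt V R := fun vs => a vs + b vs.
Definition scalA (r : R) a : alt V R := fun vs => r * a vs.
Definition linA l : alt V R := lin1 (T := R_ModuleSpace) l.

Lemma wedgeR_nil a b : wedgeR a b [] = a [] * b [].
Proof.
unfold wedgeR, wedge, lsum; cbn [unshuffles map fold_right]; modE; ring.
Qed.

(* Contraction with the first vector is a graded derivation; this recursion
   replaces sums over shuffles in all that follows. *)
Lemma wedgeR_cons a b v vs :
  wedgeR a b (v :: vs) =
  wedgeR (contract v a) b vs + wedgeR (grade a) (contract v b) vs.
Proof.
unfold wedgeR, wedge, lsum; cbn [unshuffles]; modE.
induction (unshuffles vs) as [| [[s x] y] L IH]; cbn [flat_map app map fold_right].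
- ring.
- rewrite IH; unfold contract, grade; ring.
Qed.

Lemma alt_ext a b : (forall vs, a vs = b vs) -> a = b.
Proof. apply functional_extensionality. Qed.

Lemma contract_wedge v a b :
  contract v (wedgeR a b) =
  addA (wedgeR (contract v a) b) (wedgeR (grade a) (contract v b)).
Proof. apply alt_ext; intros vs; apply wedgeR_cons. Qed.

Lemma contract_grade v a : contract v (grade a) = scalA (-1) (grade (contract v a)).
Proof.
apply alt_ext; intros vs; unfold contract, grade, scalA; cbn [length pow]; ring.
Qed.

Lemma wedgeR_addl a b c : wedgeR (addA a b) c = addA (wedgeR a c) (wedgeR b c).
Proof.
apply alt_ext; intros vs; revert a b c; unfold addA.
induction vs as [| v vs IH]; intros a b c.
- rewrite !wedgeR_nil; ring.
- rewrite !wedgeR_cons.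
  change (contract v (fun ws => a ws + b ws))
    with (fun ws => contract v a ws + contract v b ws).
  replace (grade (fun ws => a ws + b ws)) with (fun ws => grade a ws + grade b ws)
    by (apply alt_ext; intros; unfold grade; ring).
  rewrite !IH; ring.
Qed.

Lemma wedgeR_addr a b c : wedgeR a (addA b c) = addA (wedgeR a b) (wedgeR a c).
Proof.
apply alt_ext; intros vs; revert a b c; unfold addA.
induction vs as [| v vs IH]; intros a b c.
- rewrite !wedgeR_nil; ring.
- rewrite !wedgeR_cons.
  change (contract v (fun ws => b ws + c ws))
    with (fun ws => contract v b ws + contract v c ws).
  rewrite !IH; ring.
Qed.

Lemma wedgeR_scall r a b : wedgeR (scalA r a) b = scalA r (wedgeR a b).
Proof.
apply alt_ext; intros vs; revert a b; unfold scalA.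
induction vs as [| v vs IH]; intros a b.
- rewrite !wedgeR_nil; ring.
- rewrite !wedgeR_cons.
  change (contract v (fun ws => r * a ws)) with (fun ws => r * contract v a ws).
  replace (grade (fun ws => r * a ws)) with (fun ws => r * grade a ws)
    by (apply alt_ext; intros; unfold grade; ring).
  rewrite !IH; ring.
Qed.

Lemma wedgeR_scalr r a b : wedgeR a (scalA r b) = scalA r (wedgeR a b).
Proof.
apply alt_ext; intros vs; revert a b; unfold scalA.
induction vs as [| v vs IH]; intros a b.
- rewrite !wedgeR_nil; ring.
- rewrite !wedgeR_cons.
  change (contract v (fun ws => r * b ws)) with (fun ws => r * contract v b ws).
  rewrite !IH; ring.
Qed.

Lemma scalA_0 a : scalA 0 a = zeroA.
Proof. apply alt_ext; intros; unfold scalA, zeroA; ring. Qed.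

Lemma wedgeR_zerol a : wedgeR zeroA a = zeroA.
Proof. rewrite <- (scalA_0 zeroA), wedgeR_scall, !scalA_0; reflexivity. Qed.

Lemma wedgeR_zeror a : wedgeR a zeroA = zeroA.
Proof. rewrite <- (scalA_0 zeroA), wedgeR_scalr, !scalA_0; reflexivity. Qed.

Lemma grade_wedge a b : grade (wedgeR a b) = wedgeR (grade a) (grade b).
Proof.
apply alt_ext; intros vs; revert a b.
induction vs as [| v vs IH]; intros a b.
- unfold grade at 1; rewrite !wedgeR_nil; unfold grade; cbn [length pow]; ring.
- transitivity ((-1) ^ length (v :: vs) * wedgeR a b (v :: vs)); [reflexivity |].
  rewrite !wedgeR_cons, !contract_grade, wedgeR_scall, wedgeR_scalr.
  unfold scalA; rewrite <- !IH.
  generalize (contract v a) (contract v b); intros a' b'.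
  unfold grade at 2 3; cbn [length pow]; ring.
Qed.

(** Both sides obey the same recursion in the first vector, because contraction is a graded
    derivation and [grade] is multiplicative. *)
Lemma wedgeR_assoc a b c : wedgeR (wedgeR a b) c = wedgeR a (wedgeR b c).
Proof.
apply alt_ext; intros vs; revert a b c.
induction vs as [| v vs IH]; intros a b c.
- rewrite !wedgeR_nil; ring.
- rewrite !wedgeR_cons, !contract_wedge, wedgeR_addl, wedgeR_addr, grade_wedge.
  unfold addA; rewrite !IH; ring.
Qed.

Lemma contract_one v : contract v oneA = zeroA.
Proof. reflexivity. Qed.

Lemma grade_one : grade oneA = oneA.
Proof.
apply alt_ext; intros [| v vs]; unfold grade, oneA; cbn [length pow]; ring.
Qed.

Lemma wedgeR_onel a : wedgeR oneA a = a.
Proof.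
apply alt_ext; intros vs; revert a; induction vs as [| v vs IH]; intros a.
- rewrite wedgeR_nil; unfold oneA; ring.
- rewrite wedgeR_cons, contract_one, wedgeR_zerol, grade_one, IH.
  unfold zeroA, contract; ring.
Qed.

Lemma wedgeR_oner a : wedgeR a oneA = a.
Proof.
apply alt_ext; intros vs; revert a; induction vs as [| v vs IH]; intros a.
- rewrite wedgeR_nil; unfold oneA; ring.
- rewrite wedgeR_cons, contract_one, wedgeR_zeror, IH.
  unfold zeroA, contract; ring.
Qed.

Lemma contract_lin v l : contract v (linA l) = scalA (l v) oneA.
Proof.
apply alt_ext; intros [| w [| ? ?]]; unfold contract, linA, lin1, scalA, oneA; modE; ring.
Qed.

Lemma grade_lin l : grade (linA l) = scalA (-1) (linA l).
Proof.
apply alt_ext; intros [| w [| ? ?]]; unfold grade, linA, lin1, scalA;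
  cbn [length pow]; modE; ring.
Qed.

Lemma lin_wedge_cons l a v vs :
  wedgeR (linA l) a (v :: vs) = l v * a vs - wedgeR (linA l) (contract v a) vs.
Proof.
rewrite wedgeR_cons, contract_lin, grade_lin, !wedgeR_scall, wedgeR_onel.
unfold scalA; ring.
Qed.

Lemma lin_wedge_nil l a : wedgeR (linA l) a [] = 0.
Proof. rewrite wedgeR_nil; unfold linA, lin1; modE; ring. Qed.

(** Contracting either product with a vector leaves a combination of [l] and [l'], and the two
    combinations are opposite. *)
Lemma lin_anticomm l l' :
  wedgeR (linA l) (linA l') = scalA (-1) (wedgeR (linA l') (linA l)).
Proof.
apply alt_ext; intros [| v vs]; unfold scalA.
- rewrite !lin_wedge_nil; ring.
- rewrite !lin_wedge_cons, !contract_lin, !wedgeR_scalr, !wedgeR_oner.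
  unfold scalA; ring.
Qed.

Lemma lin_square l : wedgeR (linA l) (linA l) = zeroA.
Proof.
apply alt_ext; intros vs; pose proof (lin_anticomm l l) as H.
apply (f_equal (fun a => a vs)) in H; unfold scalA in H; unfold zeroA; lra.
Qed.

(** A wedge evaluates its factors only on sublists of [vs]. Hence the curvature can be replaced by
    an expression that is known to agree with it on the frame vectors only. *)
Lemma wedgeR_extr a b b' vs :
  (forall ws, incl ws vs -> b ws = b' ws) -> wedgeR a b vs = wedgeR a b' vs.
Proof.
revert a b b'; induction vs as [| v vs IH]; intros a b b' E.
- rewrite !wedgeR_nil, E by apply incl_refl; reflexivity.
- rewrite !wedgeR_cons; f_equal; apply IH; intros ws Hw.
  + apply E, incl_tl, Hw.
  + apply E, incl_cons; [left; reflexivity | apply incl_tl, Hw].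
Qed.
End Exterior.

(** * Products of linear forms *)

Section Products.
Context {V : Type}.
Implicit Types (a b : alt V R) (u v : V) (us vs : list V) (l : V -> R) (ls : list (V -> R)).

(** The decomposable form l_1 /\ ... /\ l_k; its value on k vectors is the determinant of the
    l_i(v_j). *)
Definition prodA ls : alt V R := fold_right (fun l a => wedgeR (linA l) a) oneA ls.

(* sum_i (-1)^i k(x_i) F(x_0, ..., x_i omitted, ...) *)
Fixpoint expand {X : Type} (k : X -> R) (F : list X -> R) (xs : list X) : R :=
  match xs with
  | [] => 0
  | x :: xs' => k x * F xs' - expand k (fun ys => F (x :: ys)) xs'
  end.

Lemma expand_ext {X : Type} (k k' : X -> R) F F' xs :
  (forall x, k x = k' x) -> (forall ys, F ys = F' ys) ->
  expand k F xs = expand k' F' xs.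
Proof.
intros Hk; revert F F'; induction xs as [| x xs IH]; intros F F' HF; [reflexivity |].
cbn [expand]; rewrite Hk, HF, (IH _ (fun ys => F' (x :: ys))); auto.
Qed.

Lemma expand_map {X Y : Type} (h : X -> Y) k F xs :
  expand k F (map h xs) = expand (fun x => k (h x)) (fun ys => F (map h ys)) xs.
Proof.
revert F; induction xs as [| x xs IH]; intros F; [reflexivity |].
cbn [expand map]; rewrite IH; reflexivity.
Qed.

Lemma lin_wedge_expand l a vs : wedgeR (linA l) a vs = expand l a vs.
Proof.
revert a; induction vs as [| v vs IH]; intros a.
- apply lin_wedge_nil.
- rewrite lin_wedge_cons, IH; reflexivity.
Qed.

Lemma wedge_expand {X : Type} (k : X -> R) (F : list X -> alt V R) a xs :
  wedgeR a (fun vs => expand k (fun ys => F ys vs) xs) =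
  (fun vs => expand k (fun ys => wedgeR a (F ys) vs) xs).
Proof.
revert F; induction xs as [| x xs IH]; intros F; cbn [expand].
- apply wedgeR_zeror.
- transitivity (addA (scalA (k x) (wedgeR a (F xs)))
    (scalA (-1) (wedgeR a (fun vs => expand k (fun ys => F (x :: ys) vs) xs)))).
  + rewrite <- !wedgeR_scalr, <- wedgeR_addr; f_equal.
    apply alt_ext; intros; unfold addA, scalA; ring.
  + rewrite (IH (fun ys => F (x :: ys))).
    apply alt_ext; intros; unfold addA, scalA; ring.
Qed.

(** The graded Leibniz rule: [v] reaches the i-th factor after passing the preceding ones, each of
    which costs a sign. *)
Lemma contract_prod v ls :
  contract v (prodA ls) = fun vs => expand (fun l => l v) (fun ms => prodA ms vs) ls.
Proof.
induction ls as [| l ls IH]; [reflexivity |].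
cbn [prodA fold_right]; fold (prodA ls).
rewrite contract_wedge, contract_lin, grade_lin, !wedgeR_scall, wedgeR_onel, IH.
rewrite (wedge_expand _ prodA).
apply alt_ext; intros vs; unfold addA, scalA; cbn [expand].
change (fun ys => prodA (l :: ys) vs) with (fun ys => wedgeR (linA l) (prodA ys) vs); ring.
Qed.

(* The transposition invariance of the determinant of [g u_i v_j]: expansion
   along the first vector on one side is expansion along the first factor on
   the other. *)
Lemma prod_sym (g : V -> V -> R) us vs : (forall u v, g u v = g v u) ->
  prodA (map g us) vs = prodA (map g vs) us.
Proof.
intros S; revert us; induction vs as [| v vs IH]; intros us.
- destruct us as [| u us]; [reflexivity |].
  cbn [map prodA fold_right]; rewrite lin_wedge_nil; reflexivity.
- change (contract v (prodA (map g us)) vs = prodA (map g (v :: vs)) us).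
  rewrite contract_prod, expand_map.
  cbn [map prodA fold_right]; rewrite lin_wedge_expand.
  apply expand_ext; auto.
Qed.

(** Only triangularity is asked: the matrix of the l_i(v_j) has 1 on the diagonal and 0 below it,
    which already makes its determinant 1. *)
Fixpoint dual ls vs : Prop :=
  match ls, vs with
  | [], [] => True
  | l :: ls', v :: vs' => l v = 1 /\ (forall m, In m ls' -> m v = 0) /\ dual ls' vs'
  | _, _ => False
  end.

Lemma contract_prod0 v ls : (forall l, In l ls -> l v = 0) ->
  contract v (prodA ls) = zeroA.
Proof.
induction ls as [| l ls IH]; intros H; [reflexivity |].
cbn [prodA fold_right]; fold (prodA ls).
rewrite contract_wedge, contract_lin, IH by (intros; apply H; right; assumption).
rewrite H by (left; reflexivity).
rewrite wedgeR_zeror, scalA_0, wedgeR_zerol; apply alt_ext; intros; unfold addA, zeroA; ring.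
Qed.

Lemma prod_dual ls vs : dual ls vs -> prodA ls vs = 1.
Proof.
revert vs; induction ls as [| l ls IH]; intros [| v vs] H; try contradiction.
- reflexivity.
- destruct H as (H1 & H2 & H3).
  cbn [prodA fold_right]; fold (prodA ls).
  rewrite lin_wedge_cons, contract_prod0, wedgeR_zeror, IH, H1 by assumption.
  unfold zeroA; ring.
Qed.

Lemma linA_scal r l : linA (fun v => r * l v) = scalA r (linA l).
Proof.
apply alt_ext; intros [| v [| ? ?]]; unfold linA, lin1, scalA; modE; ring.
Qed.

(** In the derivation rule, the term where [v] enters the last two factors vanishes. Repeated use
    strips a frame of the vectors on which both covectors vanish. *)
Lemma wedge_lin2_contract a l l' v vs : l v = 0 -> l' v = 0 ->
  wedgeR a (wedgeR (linA l) (linA l')) (v :: vs) =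
  wedgeR (contract v a) (wedgeR (linA l) (linA l')) vs.
Proof.
intros H H'; rewrite wedgeR_cons.
rewrite contract_wedge, grade_lin, wedgeR_scall, !contract_lin, H, H', !scalA_0.
rewrite wedgeR_zerol, wedgeR_zeror; unfold addA.
replace (fun vs => zeroA vs + scalA (-1) zeroA vs) with (zeroA (V := V))
  by (apply alt_ext; intros; unfold scalA, zeroA; ring).
rewrite wedgeR_zeror; unfold zeroA; ring.
Qed.

Lemma wedge_lin2_last a l l' u v :
  l u = 1 -> l v = 0 -> l' u = 0 -> l' v = 1 ->
  wedgeR a (wedgeR (linA l) (linA l')) [u; v] = a [].
Proof.
intros H1 H2 H3 H4; unfold wedgeR, wedge, linA, lin1, lsum.
cbn [unshuffles flat_map app map fold_right length pow]; modE.
rewrite H1, H2, H3, H4; ring.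
Qed.
End Products.

(** * Symbolic computation in an exterior algebra *)

(* Sparse elements of an exterior algebra on an ordered list of generators:
   [Gen x y] stands for [x + t /\ y] where t is the first generator and x, y
   only involve the following ones. *)
Inductive ext : Type :=
  | Zero : ext
  | Const : R -> ext
  | Gen : ext -> ext -> ext.

Fixpoint tscal (r : R) (x : ext) : ext :=
  match x with
  | Zero => Zero
  | Const s => Const (r * s)
  | Gen y z => Gen (tscal r y) (tscal r z)
  end.

Fixpoint taddr (r : R) (x : ext) : ext :=
  match x with
  | Zero => Const r
  | Const s => Const (r + s)
  | Gen y z => Gen (taddr r y) z
  end.

Fixpoint tadd (x x' : ext) : ext :=
  match x, x' with
  | Zero, _ => x'
  | Const r, _ => taddr r x'
  | Gen _ _, Zero => x
  | Gen y z, Const s => taddr s x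
  | Gen y z, Gen y' z' => Gen (tadd y y') (tadd z z')
  end.

Fixpoint tgrade (x : ext) : ext :=
  match x with
  | Zero => Zero
  | Const r => Const r
  | Gen y z => Gen (tgrade y) (tscal (-1) (tgrade z))
  end.

(** The product of y + t /\ z and y' + t /\ z' is y y' + t /\ (z y' + grade(y) z'): moving t to the
    left of y grades y, and t /\ t = 0. *)
Fixpoint tmul (x x' : ext) : ext :=
  match x' with
  | Zero => Zero
  | Const s => tscal s x
  | Gen y' z' =>
      match x with
      | Zero => Zero
      | Const r => tscal r x'
      | Gen y z => Gen (tmul y y') (tadd (tmul z y') (tmul (tgrade y) z'))
      end
  end.

Fixpoint tlin (rs : list R) : ext :=
  match rs with
  | [] => Zero
  | r :: rs' => Gen (tlin rs') (Const r)
  end.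

Section Evaluation.
Context {V : Type}.
Implicit Types (ts : list (V -> R)) (x y : ext).

(* A generator beyond the end of the list counts as 0. *)
Fixpoint eval ts x : alt V R :=
  match x with
  | Zero => zeroA
  | Const r => scalA r oneA
  | Gen y z =>
      match ts with
      | [] => eval [] y
      | t :: ts' => addA (eval ts' y) (wedgeR (linA t) (eval ts' z))
      end
  end.

Lemma eval_scal ts r x : eval ts (tscal r x) = scalA r (eval ts x).
Proof.
revert ts; induction x as [| s | y IHy z IHz]; intros ts; cbn [eval tscal].
- apply alt_ext; intros; unfold scalA, zeroA; ring.
- apply alt_ext; intros; unfold scalA; ring.
- destruct ts; rewrite IHy, ?IHz; [reflexivity |].
  rewrite wedgeR_scalr; apply alt_ext; intros; unfold addA, scalA; ring.
Qed.

Lemma eval_addr ts r x : eval ts (taddr r x) = addA (scalA r oneA) (eval ts x).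
Proof.
revert ts; induction x as [| s | y IHy z _]; intros ts; cbn [eval taddr].
- apply alt_ext; intros; unfold addA, zeroA; ring.
- apply alt_ext; intros; unfold addA, scalA; ring.
- destruct ts; rewrite IHy; [reflexivity |].
  apply alt_ext; intros; unfold addA; ring.
Qed.

Lemma eval_add ts x x' : eval ts (tadd x x') = addA (eval ts x) (eval ts x').
Proof.
revert ts x'; induction x as [| r | y IHy z IHz]; intros ts x'.
- apply alt_ext; intros; cbn [tadd eval]; unfold addA, zeroA; ring.
- apply eval_addr.
- destruct x' as [| s | y' z']; cbn [tadd].
  + apply alt_ext; intros; cbn [eval]; unfold addA, zeroA; ring.
  + rewrite eval_addr; apply alt_ext; intros; unfold addA; cbn [eval]; ring.
  + cbn [eval]; destruct ts; rewrite IHy, ?IHz; [reflexivity |].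
    rewrite wedgeR_addr; apply alt_ext; intros; unfold addA; ring.
Qed.

Lemma eval_grade_comm ts x (t : V -> R) :
  wedgeR (eval ts x) (linA t) = wedgeR (linA t) (eval ts (tgrade x)).
Proof.
revert ts; induction x as [| r | y IHy z IHz]; intros ts; cbn [eval tgrade].
- rewrite wedgeR_zerol, wedgeR_zeror; reflexivity.
- rewrite wedgeR_scall, wedgeR_scalr, wedgeR_onel, wedgeR_oner; reflexivity.
- destruct ts as [| t' ts]; [apply IHy |].
  rewrite wedgeR_addl, wedgeR_addr, IHy, eval_scal, wedgeR_assoc, IHz.
  rewrite <- wedgeR_assoc, lin_anticomm, wedgeR_scall, !wedgeR_scalr, wedgeR_assoc.
  reflexivity.
Qed.

Lemma eval_mul ts x x' : eval ts (tmul x x') = wedgeR (eval ts x) (eval ts x').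
Proof.
revert ts x; induction x' as [| s | y' IHy z' IHz]; intros ts x.
- symmetry; apply wedgeR_zeror.
- cbn [tmul eval]; rewrite eval_scal, wedgeR_scalr, wedgeR_oner; reflexivity.
- destruct x as [| r | y z]; cbn [tmul].
  + symmetry; apply wedgeR_zerol.
  + rewrite eval_scal; cbn [eval]; rewrite wedgeR_scall, wedgeR_onel; reflexivity.
  + cbn [eval]; destruct ts as [| t ts]; [apply IHy |].
    rewrite eval_add, !IHy, IHz.
    rewrite wedgeR_addl, !wedgeR_addr.
    (* Of the four products, t /\ z /\ t /\ z' is brought to the form t /\ t /\ ... and vanishes. *)
    rewrite (wedgeR_assoc (linA t) (eval ts z) (wedgeR (linA t) _)).
    rewrite <- (wedgeR_assoc (eval ts z) (linA t)), eval_grade_comm.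
    rewrite <- (wedgeR_assoc (linA t) (wedgeR (linA t) _)).
    rewrite <- (wedgeR_assoc (linA t) (linA t)), lin_square, !wedgeR_zerol.
    rewrite <- (wedgeR_assoc (eval ts y) (linA t)), eval_grade_comm, !wedgeR_assoc.
    apply alt_ext; intros; unfold addA, zeroA; ring.
Qed.

(** * Homogeneous elements and the coefficient in top degree *)

Fixpoint top (n : nat) x {struct x} : R :=
  match n, x with
  | O, Const r => r
  | S n', Gen _ z => top n' z
  | _, _ => 0
  end.

(** Degree [k] in at most [n] generators. [Zero] has every degree, so that homogeneity is preserved
    by the operations on trees. *)
Fixpoint homogeneous (n k : nat) x {struct x} : Prop :=
  match x with
  | Zero => True
  | Const _ => k = 0%nat
  | Gen y z =>
      match n, k with
      | S n', S k' => homogeneous n' k y /\ homogeneous n' k' z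
      | _, _ => False
      end
  end.

Lemma homogeneous_scal n k r x : homogeneous n k x -> homogeneous n k (tscal r x).
Proof.
revert n k; induction x as [| s | y IHy z IHz]; intros n k H; try exact H.
destruct n, k; try contradiction; destruct H; split; auto.
Qed.

Lemma homogeneous_grade n k x : homogeneous n k x -> homogeneous n k (tgrade x).
Proof.
revert n k; induction x as [| s | y IHy z IHz]; intros n k H; try exact H.
destruct n, k; try contradiction; destruct H; split; auto using homogeneous_scal.
Qed.

Lemma homogeneous_addr n r x : homogeneous n 0 x -> homogeneous n 0 (taddr r x).
Proof. destruct x, n; cbn; auto; contradiction. Qed.

Lemma homogeneous_add n k x x' :
  homogeneous n k x -> homogeneous n k x' -> homogeneous n k (tadd x x').
Proof.
revert n k x'; induction x as [| r | y IHy z IHz]; intros n k x' H H'.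
- exact H'.
- cbn in H; subst k; apply homogeneous_addr, H'.
- destruct x' as [| s | y' z'].
  + exact H.
  + cbn in H'; subst k; apply homogeneous_addr, H.
  + destruct n, k; try contradiction; destruct H, H'; split; auto.
Qed.

Lemma homogeneous_mul n j k x x' :
  homogeneous n j x -> homogeneous n k x' -> homogeneous n (j + k) (tmul x x').
Proof.
revert j k x x'; induction n as [| n IH]; intros j k x [| s | y' z'] H H';
  try exact I; try contradiction.
1, 2: cbn in H'; subst k; rewrite Nat.add_0_r; apply homogeneous_scal, H.
destruct x as [| r | y z].
- exact I.
- cbn in H; subst j; apply homogeneous_scal, H'.
- destruct j, k; try contradiction; destruct H as [H1 H2], H' as [H3 H4].
  cbn [tmul Nat.add homogeneous]; split.
  + apply (IH (S j) (S k)); assumption.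
  + apply homogeneous_add; [apply IH; assumption |].
    rewrite Nat.add_succ_r; apply (IH (S j) k); [apply homogeneous_grade |]; assumption.
Qed.

Lemma eval_above ts k x : homogeneous (length ts) k x -> (length ts < k)%nat ->
  eval ts x = zeroA.
Proof.
revert ts k; induction x as [| r | y IHy z IHz]; intros [| t ts] k H L;
  try contradiction; try (cbn in H, L; lia); try reflexivity.
destruct k; [contradiction |]; cbn [length] in *; destruct H as [H1 H2].
cbn [eval]; rewrite (IHy ts (S k)), (IHz ts k), wedgeR_zeror by (assumption || lia).
apply alt_ext; intros; unfold addA, zeroA; ring.
Qed.

(** The part without the first generator has degree larger than the number of generators left, so
    [eval_above] kills it at every level. *)
Lemma eval_top ts x : homogeneous (length ts) (length ts) x ->
  eval ts x = scalA (top (length ts) x) (prodA ts).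
Proof.
revert ts; induction x as [| r | y IHy z IHz]; intros ts H.
- destruct ts; symmetry; apply scalA_0.
- destruct ts; [reflexivity | discriminate].
- destruct ts as [| t ts]; [contradiction |]; cbn [length] in H; destruct H as [H1 H2].
  cbn [eval prodA fold_right length top]; fold (prodA ts).
  rewrite (eval_above ts (S (length ts)) y H1) by lia; rewrite IHz, wedgeR_scalr by exact H2.
  apply alt_ext; intros; unfold addA, zeroA; ring.
Qed.

Lemma homogeneous_lin n rs : length rs = n -> homogeneous n 1 (tlin rs).
Proof.
intros <-; induction rs as [| r rs IH]; cbn; auto.
Qed.

(** Expanding every factor in the generators gives a tree of top degree; the scalar is the
    determinant of the coefficients. *)
Lemma prod_span_top ts ls : length ls = length ts ->
  (forall l, In l ls -> exists rs, length rs = length ts /\ linA l = eval ts (tlin rs)) ->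
  exists r, prodA ls = scalA r (prodA ts).
Proof.
intros L H.
assert (K : exists x, homogeneous (length ts) (length ls) x /\ prodA ls = eval ts x).
{ clear L; induction ls as [| l ls IH].
  - exists (Const 1); split; [reflexivity |].
    apply alt_ext; intros; cbn [prodA fold_right eval]; unfold scalA; ring.
  - destruct IH as (x & Hx & Ex); [intros; apply H; right; assumption |].
    destruct (H l) as (rs & Hr & Er); [left; reflexivity |].
    exists (tmul (tlin rs) x); split.
    + apply (homogeneous_mul _ 1); [apply homogeneous_lin |]; assumption.
    + rewrite eval_mul, <- Er, <- Ex; reflexivity. }
destruct K as (x & Hx & ->); rewrite L in Hx.
exists (top (length ts) x); apply eval_top, Hx.
Qed.

(* det(E)^2 det(g) = 1 for a g-orthonormal basis E, in a form which needs
   neither a basis nor a linear structure on V: [ts] are coordinates and [ds]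
   the dual vectors. *)
Lemma orthonormal_volume (g : V -> V -> R) ts ds es :
  (forall u v, g u v = g v u) -> length es = length ts ->
  (forall v, In v es ->
     exists rs, length rs = length ts /\ linA (g v) = eval ts (tlin rs)) ->
  dual ts ds -> dual (map g es) es ->
  prodA (map g ds) es * prodA ts es = 1.
Proof.
intros S L H D E.
(* Duality on [es] gives r times [prodA ts es] equal to 1, while transposition followed by duality
   on [ds] identifies r with [prodA (map g ds) es]. *)
destruct (prod_span_top ts (map g es)) as [r Hr].
- rewrite length_map; exact L.
- intros l Hl; apply in_map_iff in Hl; destruct Hl as (v & <- & Hv); auto.
- rewrite (prod_sym g ds es S), Hr; unfold scalA.
  rewrite (prod_dual ts ds D), Rmult_1_r.
  apply prod_dual in E; rewrite Hr in E; exact E.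
Qed.
End Evaluation.

(** * The Hodge star at a point *)

Section Pointwise.
Context {V : Type} (a w : V -> quat).

Definition coframe : list (V -> R) :=
  [fun v => q0 (a v); fun v => q1 (a v); fun v => q2 (a v); fun v => q3 (a v);
   fun v => q0 (w v); fun v => q1 (w v); fun v => q2 (w v); fun v => q3 (w v)].

(** The 4-form [Psi] at one point, with [s], [t] for the values of sigma, tau and [a], [w] for
    alpha, omega. *)
Definition cayley (s t : R) : alt V R := fun vs =>
  s ^ 2 * e0123 a vs +
  s * t * (wedgeR (asd1 a) (asd1 w) vs + wedgeR (asd2 a) (asd2 w) vs +
           wedgeR (asd3 a) (asd3 w) vs) +
  t ^ 2 * e0123 w vs.

Definition sd1 : alt V R := fun vs => wedgeR (e0 a) (e1 a) vs + wedgeR (e2 a) (e3 a) vs.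
Definition sd2 : alt V R := fun vs => wedgeR (e0 a) (e2 a) vs + wedgeR (e3 a) (e1 a) vs.
Definition sd3 : alt V R := fun vs => wedgeR (e0 a) (e3 a) vs + wedgeR (e1 a) (e2 a) vs.

(* A family of solutions of *(Psi /\ F) = F that contains the components of the
   curvature. *)
Definition lambda21 (s t m1 m2 m3 n1 n2 n3 : R) : alt V R := fun vs =>
  m1 * (s * asd1 a vs + t * asd1 w vs) + m2 * (s * asd2 a vs + t * asd2 w vs) +
  m3 * (s * asd3 a vs + t * asd3 w vs) +
  (n1 * sd1 vs + n2 * sd2 vs + n3 * sd3 vs).

Definition metric (s t : R) (u v : V) : R :=
  s * qdot (a u) (a v) + t * qdot (w u) (w v).

Definition volume : alt V R := wedgeR (e0123 a) (e0123 w).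

Definition gen (k : nat) : ext := Nat.iter k (fun x => Gen x Zero) (Gen Zero (Const 1)).
Definition tsub (x y : ext) : ext := tadd x (tscal (-1) y).
(** Here [k] is the position of the first of four consecutive generators: 0 for the components of
    [a], 4 for those of [w]. *)
Definition tasd1 k := tsub (tmul (gen k) (gen (k + 1))) (tmul (gen (k + 2)) (gen (k + 3))).
Definition tasd2 k := tsub (tmul (gen k) (gen (k + 2))) (tmul (gen (k + 3)) (gen (k + 1))).
Definition tasd3 k := tsub (tmul (gen k) (gen (k + 3))) (tmul (gen (k + 1)) (gen (k + 2))).
Definition tvol4 k :=
  tmul (tmul (tmul (gen k) (gen (k + 1))) (gen (k + 2))) (gen (k + 3)).
Definition tcayley (s t : R) : ext :=
  tadd (tadd (tscal (s ^ 2) (tvol4 0))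
    (tscal (s * t) (tadd (tadd (tmul (tasd1 0) (tasd1 4)) (tmul (tasd2 0) (tasd2 4)))
                         (tmul (tasd3 0) (tasd3 4)))))
    (tscal (t ^ 2) (tvol4 4)).
Definition tlambda21 (s t m1 m2 m3 n1 n2 n3 : R) : ext :=
  tadd (tadd (tadd
    (tscal m1 (tadd (tscal s (tasd1 0)) (tscal t (tasd1 4))))
    (tscal m2 (tadd (tscal s (tasd2 0)) (tscal t (tasd2 4)))))
    (tscal m3 (tadd (tscal s (tasd3 0)) (tscal t (tasd3 4)))))
    (tadd (tadd
      (tscal n1 (tadd (tmul (gen 0) (gen 1)) (tmul (gen 2) (gen 3))))
      (tscal n2 (tadd (tmul (gen 0) (gen 2)) (tmul (gen 3) (gen 1)))))
      (tscal n3 (tadd (tmul (gen 0) (gen 3)) (tmul (gen 1) (gen 2))))).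

Lemma eval_gen ts k : (k < length ts)%nat ->
  eval ts (gen k) = linA (nth k ts (fun _ : V => 0)).
Proof.
revert k; induction ts as [| t ts IH]; intros [| k] H; cbn [length] in H; try lia.
- change (eval (t :: ts) (Gen Zero (Const 1)) = linA t); cbn [eval].
  rewrite wedgeR_scalr, wedgeR_oner.
  apply alt_ext; intros; unfold addA, scalA, zeroA; ring.
- change (eval (t :: ts) (Gen (gen k) Zero) = linA (nth k ts (fun _ => 0))).
  cbn [eval]; rewrite IH, wedgeR_zeror by lia.
  apply alt_ext; intros; unfold addA, zeroA; ring.
Qed.

Lemma eval_sub (ts : list (V -> R)) x y :
  eval ts (tsub x y) = fun vs => eval ts x vs - eval ts y vs.
Proof.
unfold tsub; rewrite eval_add, eval_scal.
apply alt_ext; intros; unfold addA, scalA; ring.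
Qed.

Ltac eval_tree :=
  repeat (rewrite eval_add || rewrite eval_scal || rewrite eval_sub || rewrite eval_mul);
  rewrite ?eval_gen by (cbn; lia); reflexivity.

Lemma eval_cayley s t : eval coframe (tcayley s t) = cayley s t.
Proof. unfold tcayley, tasd1, tasd2, tasd3, tvol4; eval_tree. Qed.

Lemma eval_lambda21 s t m1 m2 m3 n1 n2 n3 :
  eval coframe (tlambda21 s t m1 m2 m3 n1 n2 n3) = lambda21 s t m1 m2 m3 n1 n2 n3.
Proof. unfold tlambda21, tasd1, tasd2, tasd3; eval_tree. Qed.

Lemma eval_volume : eval coframe (tmul (tvol4 0) (tvol4 4)) = volume.
Proof. unfold tvol4; eval_tree. Qed.

Definition tcovector (s t : R) (u : V) : ext :=
  tlin [s * q0 (a u); s * q1 (a u); s * q2 (a u); s * q3 (a u);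
        t * q0 (w u); t * q1 (w u); t * q2 (w u); t * q3 (w u)].

Lemma eval_covector s t u : eval coframe (tcovector s t u) = linA (metric s t u).
Proof.
unfold tcovector; cbn [tlin eval coframe].
rewrite !wedgeR_scalr, !wedgeR_oner.
apply alt_ext; intros [| v [| ? ?]]; unfold addA, scalA, zeroA, linA, lin1, metric, qdot;
  modE; ring.
Qed.

(** Both sides have top degree in the eight coframe elements, so only one coefficient has to be
    compared, a polynomial in the coordinates of [u] and [v]. *)
Lemma cayley_lambda21 s t m1 m2 m3 n1 n2 n3 u v vs :
  wedgeR (wedgeR (cayley s t) (lambda21 s t m1 m2 m3 n1 n2 n3))
         (wedgeR (linA (metric s t u)) (linA (metric s t v))) vs =
  s ^ 2 * t ^ 2 * lambda21 s t m1 m2 m3 n1 n2 n3 [u; v] * volume vs.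
Proof.
(* Naming the value F(u, v) protects it from the translation of forms into trees. *)
set (r := lambda21 s t m1 m2 m3 n1 n2 n3 [u; v]).
rewrite <- eval_cayley, <- eval_lambda21, <- !eval_covector, <- eval_volume, <- !eval_mul.
rewrite !eval_top.
- unfold scalA; rewrite <- Rmult_assoc; f_equal.
  cbv -[Rplus Rmult Ropp Rminus pow IZR q0 q1 q2 q3].
  ring.
- apply (homogeneous_mul 8 4 4); cbn; tauto.
- apply (homogeneous_mul 8 6 2).
  + apply (homogeneous_mul 8 4 2); cbn; tauto.
  + apply (homogeneous_mul 8 1 1); apply homogeneous_lin; reflexivity.
Qed.

(** The covectors dual to [v6] and [v7] vanish on the other six vectors, so wedging with them turns
    a value on [v0], ..., [v5] into a value on the whole frame, to which [cayley_lambda21]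
    applies. *)
Lemma hodge_pointwise s t m1 m2 m3 n1 n2 n3 v0 v1 v2 v3 v4 v5 v6 v7 :
  let es := [v0; v1; v2; v3; v4; v5; v6; v7] in
  dual (map (metric s t) es) es -> s ^ 2 * t ^ 2 * volume es = 1 ->
  wedgeR (cayley s t) (lambda21 s t m1 m2 m3 n1 n2 n3) [v0; v1; v2; v3; v4; v5] =
  lambda21 s t m1 m2 m3 n1 n2 n3 [v6; v7].
Proof.
intros es D N.
transitivity (wedgeR (wedgeR (cayley s t) (lambda21 s t m1 m2 m3 n1 n2 n3))
         (wedgeR (linA (metric s t v6)) (linA (metric s t v7))) es).
2: { rewrite cayley_lambda21; 
  transitivity (s ^ 2 * t ^ 2 * volume es * lambda21 s t m1 m2 m3 n1 n2 n3 [v6; v7]);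
    [ring | rewrite N; ring]. }
generalize (wedgeR (cayley s t) (lambda21 s t m1 m2 m3 n1 n2 n3)); intros b.
unfold es in *; clear es N.
cbn in D.
destruct D as (_ & D0 & _ & D1 & _ & D2 & _ & D3 & _ & D4 & _ & D5 & D66 & D6 & D77 & _).
assert (D76 : metric s t v7 v6 = 0) by (apply D6; tauto).
rewrite (wedge_lin2_contract _ _ _ v0), (wedge_lin2_contract _ _ _ v1),
  (wedge_lin2_contract _ _ _ v2), (wedge_lin2_contract _ _ _ v3),
  (wedge_lin2_contract _ _ _ v4), (wedge_lin2_contract _ _ _ v5)
  by (first [apply D0 | apply D1 | apply D2 | apply D3 | apply D4 | apply D5]; tauto).
symmetry; refine (eq_trans (wedge_lin2_last _ _ _ _ _ D66 _ D76 D77) _); [| reflexivity].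
(* [dual] gives orthogonality of [v6] and [v7] in one order only; symmetry of the metric supplies
   the other. *)
rewrite <- D76; unfold metric, qdot; ring.
Qed.

(** The Gram matrix of the metric in the coframe has determinant s^4 t^4, so the square of the
    left-hand side is 1; the orientation selects the root 1. *)
Lemma orthonormal_cayley_volume s t es : 0 < s -> 0 < t ->
  (forall x y, exists v, a v = x /\ w v = y) -> length es = 8%nat ->
  dual (map (metric s t) es) es -> 0 < volume es -> s ^ 2 * t ^ 2 * volume es = 1.
Proof.
intros Hs Ht S L D P.
(* The vectors [d0], ..., [d7] are dual to [coframe]. *)
destruct (S (1, 0, 0, 0) (qreal 0)) as (d0 & A0 & B0).
destruct (S (0, 1, 0, 0) (qreal 0)) as (d1 & A1 & B1).
destruct (S (0, 0, 1, 0) (qreal 0)) as (d2 & A2 & B2).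
destruct (S (0, 0, 0, 1) (qreal 0)) as (d3 & A3 & B3).
destruct (S (qreal 0) (1, 0, 0, 0)) as (d4 & A4 & B4).
destruct (S (qreal 0) (0, 1, 0, 0)) as (d5 & A5 & B5).
destruct (S (qreal 0) (0, 0, 1, 0)) as (d6 & A6 & B6).
destruct (S (qreal 0) (0, 0, 0, 1)) as (d7 & A7 & B7).
assert (V1 : volume = prodA coframe).
{ rewrite <- eval_volume, eval_top.
  - apply alt_ext; intros; unfold scalA; cbn; ring.
  - apply (homogeneous_mul 8 4 4); cbn; tauto. }
assert (Q := orthonormal_volume (metric s t) coframe [d0; d1; d2; d3; d4; d5; d6; d7] es).
rewrite <- V1 in Q.
(* Lowering the index of a dual vector gives [s] times the coframe element for the first four, [t]
   times it for the last four. *)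
assert (G : prodA (map (metric s t) [d0; d1; d2; d3; d4; d5; d6; d7]) es =
            s ^ 4 * t ^ 4 * volume es).
{ replace (map _ _) with
   [fun v => s * q0 (a v); fun v => s * q1 (a v); fun v => s * q2 (a v);
    fun v => s * q3 (a v); fun v => t * q0 (w v); fun v => t * q1 (w v);
    fun v => t * q2 (w v); fun v => t * q3 (w v)].
  - cbn [prodA fold_right]; rewrite !linA_scal, !wedgeR_scall, !wedgeR_scalr.
    rewrite V1; cbn [prodA fold_right coframe]; unfold scalA; ring.
  - cbn [map]; unfold metric, qdot;
      rewrite A0, A1, A2, A3, A4, A5, A6, A7, B0, B1, B2, B3, B4, B5, B6, B7.
    repeat (apply f_equal2; [apply functional_extensionality; intros; cbn; ring |]).
    reflexivity. }
rewrite G in Q.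
assert (E : (s ^ 2 * t ^ 2 * volume es) ^ 2 = 1).
{ rewrite <- Q; [ring | | exact L | | | exact D].
  - intros; unfold metric, qdot; ring.
  - intros v _; eexists; split; [| symmetry; apply eval_covector]; reflexivity.
  - cbn [coframe dual]; rewrite A0, A1, A2, A3, B4, B5, B6, B7.
    repeat split; try reflexivity; intros m;
      apply (proj1 (List.Forall_forall (fun m => m _ = 0) _));
      repeat constructor; cbv beta; rewrite ?A0, ?A1, ?A2, ?A3, ?A4, ?A5, ?A6,
        ?B0, ?B1, ?B2, ?B3, ?B4, ?B5, ?B6; reflexivity. }
assert (0 < s ^ 2 * t ^ 2 * volume es)
  by (apply Rmult_lt_0_compat; [apply Rmult_lt_0_compat; apply pow_lt |]; assumption).
nra.
Qed.
End Pointwise.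

(** * Directional derivatives *)

(** [dirD] is total, being built on [Derive]; the relation also records differentiability, as the
    product and chain rules require. *)
Definition is_dirD (F : point -> R) (v x : point) (l : R) : Prop :=
  is_derive (fun t : R => F (plus x (scal t v))) 0 l.

Definition is_dirDq (F : point -> quat) (v x : point) (l : quat) : Prop :=
  is_dirD (fun y => q0 (F y)) v x (q0 l) /\ is_dirD (fun y => q1 (F y)) v x (q1 l) /\
  is_dirD (fun y => q2 (F y)) v x (q2 l) /\ is_dirD (fun y => q3 (F y)) v x (q3 l).

Lemma is_dirD_unique F v x l : is_dirD F v x l -> dirD F v x = l.
Proof. apply is_derive_unique. Qed.

Lemma is_dirDq_unique F v x l : is_dirDq F v x l -> dirDq F v x = l.
Proof.
intros (H0 & H1 & H2 & H3); unfold dirDq.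
rewrite (is_dirD_unique _ _ _ _ H0), (is_dirD_unique _ _ _ _ H1),
  (is_dirD_unique _ _ _ _ H2), (is_dirD_unique _ _ _ _ H3).
destruct l as [[[? ?] ?] ?]; reflexivity.
Qed.

Lemma line_0 (x v : point) : plus x (scal 0 v) = x.
Proof.
transitivity (plus x (zero : point)); [f_equal; apply (scal_zero_l v) | apply plus_zero_r].
Qed.

Lemma is_dirD_const c v x : is_dirD (fun _ => c) v x 0.
Proof. exact (@is_derive_const R_AbsRing R_NormedModule c 0). Qed.

Lemma is_dirD_plus F G v x l m : is_dirD F v x l -> is_dirD G v x m ->
  is_dirD (fun y => F y + G y) v x (l + m).
Proof. exact (@is_derive_plus R_AbsRing R_NormedModule _ _ 0 l m). Qed.

Lemma is_dirD_opp F v x l : is_dirD F v x l -> is_dirD (fun y => - F y) v x (- l).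
Proof. exact (@is_derive_opp R_AbsRing R_NormedModule _ 0 l). Qed.

Lemma is_dirD_mult F G v x l m : is_dirD F v x l -> is_dirD G v x m ->
  is_dirD (fun y => F y * G y) v x (l * G x + F x * m).
Proof.
intros HF HG; rewrite <- (line_0 x v) at 2 3.
apply (is_derive_mult (fun t : R => F (plus x (scal t v)))
         (fun t : R => G (plus x (scal t v))) 0 l m HF HG); intros; apply Rmult_comm.
Qed.

Lemma is_dirD_comp (h : R -> R) F v x l m :
  is_dirD F v x l -> is_derive h (F x) m -> is_dirD (fun y => h (F y)) v x (l * m).
Proof.
intros HF Hh; rewrite <- (line_0 x v) in Hh.
exact (is_derive_comp h (fun t : R => F (plus x (scal t v))) 0 m l Hh HF).
Qed.

Lemma is_dirD_ext F G v x l : (forall y, F y = G y) -> is_dirD F v x l -> is_dirD G v x l.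
Proof. intros E; apply is_derive_ext; intros; apply E. Qed.

Ltac split4 := refine (conj _ (conj _ (conj _ _))).

Lemma is_dirDq_add F G v x l m : is_dirDq F v x l -> is_dirDq G v x m ->
  is_dirDq (fun y => qadd (F y) (G y)) v x (qadd l m).
Proof.
intros (F0 & F1 & F2 & F3) (G0 & G1 & G2 & G3).
split4; eapply is_dirD_plus; eassumption.
Qed.

Lemma is_dirDq_opp F v x l : is_dirDq F v x l ->
  is_dirDq (fun y => qopp (F y)) v x (qopp l).
Proof.
intros (F0 & F1 & F2 & F3); split4; eapply is_dirD_opp; eassumption.
Qed.

Lemma is_dirDq_conj F v x l : is_dirDq F v x l ->
  is_dirDq (fun y => qconj (F y)) v x (qconj l).
Proof.
intros (F0 & F1 & F2 & F3); split4; [exact F0 | eapply is_dirD_opp; eassumption ..].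
Qed.

Lemma is_dirDq_im F v x l : is_dirDq F v x l ->
  is_dirDq (fun y => qim (F y)) v x (qim l).
Proof.
intros (F0 & F1 & F2 & F3); split4; [exact (is_dirD_const 0 v x) | assumption ..].
Qed.

Lemma is_dirDq_scal F G v x l m : is_dirD F v x l -> is_dirDq G v x m ->
  is_dirDq (fun y => qscal (F y) (G y)) v x (qadd (qscal l (G x)) (qscal (F x) m)).
Proof.
intros HF (G0 & G1 & G2 & G3).
split4; eapply is_dirD_mult; eassumption.
Qed.

Lemma is_dirDq_mul F G v x l m : is_dirDq F v x l -> is_dirDq G v x m ->
  is_dirDq (fun y => qmul (F y) (G y)) v x (qadd (qmul l (G x)) (qmul (F x) m)).
Proof.
intros (F0 & F1 & F2 & F3) (G0 & G1 & G2 & G3).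
assert (K : forall (A B C E : point -> R) (dA dB dC dE l : R),
  is_dirD A v x dA -> is_dirD B v x dB -> is_dirD C v x dC -> is_dirD E v x dE ->
  l = dA + dB + dC + dE -> is_dirD (fun y => A y + B y + C y + E y) v x l)
  by (intros A B C E dA dB dC dE l' HA HB HC HE ->; repeat apply is_dirD_plus; assumption).
split4.
- apply is_dirD_ext with (fun y => q0 (F y) * q0 (G y) + - (q1 (F y) * q1 (G y)) +
    - (q2 (F y) * q2 (G y)) + - (q3 (F y) * q3 (G y)));
    [intros; reflexivity |].
  eapply K; [apply is_dirD_mult | apply is_dirD_opp, is_dirD_mult ..| ]; try eassumption.
  cbv beta; generalize (F x) (G x); clear; intros; qext; ring.
- apply is_dirD_ext with (fun y => q0 (F y) * q1 (G y) + q1 (F y) * q0 (G y) +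
    q2 (F y) * q3 (G y) + - (q3 (F y) * q2 (G y))); [intros; reflexivity |].
  eapply K; [apply is_dirD_mult .. | apply is_dirD_opp, is_dirD_mult | ]; try eassumption.
  cbv beta; generalize (F x) (G x); clear; intros; qext; ring.
- apply is_dirD_ext with (fun y => q0 (F y) * q2 (G y) + - (q1 (F y) * q3 (G y)) +
    q2 (F y) * q0 (G y) + q3 (F y) * q1 (G y)); [intros; reflexivity |].
  eapply K; [apply is_dirD_mult | apply is_dirD_opp, is_dirD_mult
            | apply is_dirD_mult .. | ]; try eassumption.
  cbv beta; generalize (F x) (G x); clear; intros; qext; ring.
- apply is_dirD_ext with (fun y => q0 (F y) * q3 (G y) + q1 (F y) * q2 (G y) +
    - (q2 (F y) * q1 (G y)) + q3 (F y) * q0 (G y)); [intros; reflexivity |].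
  eapply K; [apply is_dirD_mult .. | apply is_dirD_opp, is_dirD_mult
            | apply is_dirD_mult | ]; try eassumption.
  cbv beta; generalize (F x) (G x); clear; intros; qext; ring.
Qed.

Lemma is_dirDq_affine F v x l :
  (forall t : R, F (plus x (scal t v)) = qadd (F x) (qscal t l)) ->
  is_dirDq F v x l.
Proof.
intros H; assert (K : forall q : quat -> R, (forall t, q (qadd (F x) (qscal t l)) =
  q (F x) + t * q l) -> is_dirD (fun y => q (F y)) v x (q l)).
{ intros q Hq; apply is_derive_ext with (fun t : R => q (F x) + t * q l).
  - intros t; rewrite H, Hq; reflexivity.
  - auto_derive; trivial; ring. }
split4; apply K; reflexivity.
Qed.

(** * Curvature *)

(** [phi y w] is the lower right entry of y^* w, hence real-linear in y. *)
Lemma is_dirDq_phi v w x :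
  is_dirDq (fun y => phi y w) v x (m22 (mmul (madj (fst v)) (fst w))).
Proof.
apply is_dirDq_affine; intros t; unfold phi; rewrite mc_22.
f_equal; generalize (m22 (mmul (madj (fst v)) (fst w))); clear; qring.
Qed.

Lemma is_dirDq_fibre v x : is_dirDq fibre v x (snd v).
Proof. apply is_dirDq_affine; reflexivity. Qed.

Lemma is_dirDq_alpha v w x :
  is_dirDq (fun y => alpha y w) v x
    (qopp (qadd (qmul (snd v) (phi x w))
                (qmul (fibre x) (m22 (mmul (madj (fst v)) (fst w)))))).
Proof.
assert (C : is_dirDq (fun _ => snd w) v x (qreal 0)) by (split4; apply is_dirD_const).
assert (H := is_dirDq_add _ _ _ _ _ _ C (is_dirDq_opp _ _ _ _
               (is_dirDq_mul _ _ _ _ _ _ (is_dirDq_fibre v x) (is_dirDq_phi v w x)))).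
assert (Z : forall l, qadd (qreal 0) l = l) by qring.
rewrite Z in H; exact H.
Qed.

Lemma is_dirD_radius2 v x : is_dirD radius2 v x (2 * qdot (fibre x) (snd v)).
Proof.
destruct (is_dirDq_mul _ _ _ _ _ _ (is_dirDq_fibre v x)
            (is_dirDq_conj _ _ _ _ (is_dirDq_fibre v x))) as (H & _).
match type of H with is_dirD _ _ _ ?l => replace l with (2 * qdot (fibre x) (snd v)) in H end.
- exact H.
- generalize (fibre x) (snd v); clear; intros; qext; ring.
Qed.

(** The coefficient is kept arbitrary: the instanton equation then becomes an ordinary differential
    equation for [h], solved afterwards by [f D]. *)
Definition radial_conn (h : R -> R) (x v : point) : quat :=
  qadd (phi x v) (qscal (h (radius2 x)) (A2 x v)).

Lemma is_dirDq_radial_conn (h : R -> R) (dh : R) v w x : is_derive h (radius2 x) dh ->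
  is_dirDq (fun y => radial_conn h y w) v x
    (let P := m22 (mmul (madj (fst v)) (fst w)) in
     qadd P
       (qadd (qscal (2 * qdot (fibre x) (snd v) * dh) (A2 x w))
             (qscal (h (radius2 x))
                (qim (qadd (qmul (qconj (snd v)) (alpha x w))
                   (qmul (qconj (fibre x))
                     (qopp (qadd (qmul (snd v) (phi x w)) (qmul (fibre x) P))))))))).
Proof.
intros Hh.
apply (is_dirDq_add _ _ _ _ _ _ (is_dirDq_phi v w x)).
apply (is_dirDq_scal (fun y => h (radius2 y)) (fun y => A2 y w)).
- exact (is_dirD_comp h radius2 v x _ _ (is_dirD_radius2 v x) Hh).
- apply (is_dirDq_im (fun y => qmul (qconj (fibre y)) (alpha y w))).
  apply (is_dirDq_mul (fun y => qconj (fibre y)) (fun y => alpha y w)).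
  + apply is_dirDq_conj, is_dirDq_fibre.
  + apply is_dirDq_alpha.
Qed.

Lemma phi_imaginary x v : tangent x v -> q0 (phi x v) = 0.
Proof.
intros H; apply (f_equal (fun m => q0 (m22 m))) in H; revert H.
change (phi x v) with (m22 (mmul (madj (fst x)) (fst v))).
generalize (mmul (madj (fst x)) (fst v)); intros [[? ?] [? ?]].
unfold madj, mopp, m22; cbn [fst snd]; intros; qext; lra.
Qed.

Definition sd {V : Type} (c : V -> quat) : alt V quat :=
  fun vs => (0, sd1 c vs, sd2 c vs, sd3 c vs).

Lemma asd_pair {V : Type} (c : V -> quat) v w :
  asd c [v; w] =
  (0, q0 (c v) * q1 (c w) - q0 (c w) * q1 (c v) - (q2 (c v) * q3 (c w) - q2 (c w) * q3 (c v)),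
      q0 (c v) * q2 (c w) - q0 (c w) * q2 (c v) - (q3 (c v) * q1 (c w) - q3 (c w) * q1 (c v)),
      q0 (c v) * q3 (c w) - q0 (c w) * q3 (c v) - (q1 (c v) * q2 (c w) - q1 (c w) * q2 (c v))).
Proof.
unfold asd, asd1, asd2, asd3, e0, e1, e2, e3, wedgeR, wedge, lin1, lsum;
  cbn [unshuffles flat_map app map fold_right length pow].
modE; qpair; ring.
Qed.

Lemma sd_pair {V : Type} (c : V -> quat) v w :
  sd c [v; w] =
  (0, q0 (c v) * q1 (c w) - q0 (c w) * q1 (c v) + (q2 (c v) * q3 (c w) - q2 (c w) * q3 (c v)),
      q0 (c v) * q2 (c w) - q0 (c w) * q2 (c v) + (q3 (c v) * q1 (c w) - q3 (c w) * q1 (c v)),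
      q0 (c v) * q3 (c w) - q0 (c w) * q3 (c v) + (q1 (c v) * q2 (c w) - q1 (c w) * q2 (c v))).
Proof.
unfold sd, sd1, sd2, sd3, e0, e1, e2, e3, wedgeR, wedge, lin1, lsum;
  cbn [unshuffles flat_map app map fold_right length pow].
modE; qpair; ring.
Qed.

(** Once da is written as alpha + a phi and d phi is eliminated by the structure equation, all terms
    containing phi cancel and a polynomial identity in quaternion coordinates remains. *)
Lemma radial_conn_curvature kappa (h : R -> R) (dh : R) x v w : 0 < kappa -> total x ->
  tangent x v -> tangent x w -> is_derive h (radius2 x) dh ->
  curvature (radial_conn h) x [v; w] =
  let r := radius2 x in
  qadd (qscal (kappa / 2 * (1 - h r * r)) (asd (omega kappa x) [v; w]))
  (qadd (qscal (2 * h r + dh * r - h r ^ 2 * r) (asd (alpha x) [v; w]))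
        (qscal (dh + h r ^ 2) (sd (fun u => qmul (qconj (fibre x)) (alpha x u)) [v; w]))).
Proof.
intros Hk Hx Hv Hw Hh; cbv zeta.
assert (SP := structure_phi kappa x v w Hk Hx Hv Hw).
rewrite extd_1form, wedgeH_11 in SP.
rewrite (is_dirDq_unique _ _ _ _ (is_dirDq_phi v w x)),
  (is_dirDq_unique _ _ _ _ (is_dirDq_phi w v x)) in SP.
unfold curvature; rewrite extd_1form, wedgeH_11.
rewrite (is_dirDq_unique _ _ _ _ (is_dirDq_radial_conn _ _ v w _ Hh)),
  (is_dirDq_unique _ _ _ _ (is_dirDq_radial_conn _ _ w v _ Hh)).
cbv zeta; unfold radial_conn, A2; rewrite (asd_pair (alpha x)), sd_pair.
set (O := asd (omega kappa x) [v; w]) in *.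
assert (HO : q0 O = 0) by reflexivity.
assert (Ev : snd v = qadd (alpha x v) (qmul (fibre x) (phi x v)))
  by (unfold alpha; generalize (qmul (fibre x) (phi x v)) (snd v); clear; qring).
assert (Ew : snd w = qadd (alpha x w) (qmul (fibre x) (phi x w)))
  by (unfold alpha; generalize (qmul (fibre x) (phi x w)) (snd w); clear; qring).
rewrite Ev, Ew; clear Ev Ew Hh.
rewrite radius2E.
assert (Pv := phi_imaginary x v Hv); assert (Pw := phi_imaginary x w Hw).
clearbody O.
generalize dependent (m22 (mmul (madj (fst v)) (fst w))).
generalize dependent (m22 (mmul (madj (fst w)) (fst v))).
generalize dependent (phi x v); generalize dependent (phi x w).
generalize (h (qnorm2 (fibre x))).
generalize (alpha x v) (alpha x w) (fibre x).
clear - HO; intros av aw a c pw Pw pv Pv Q P SP.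
(* P - Q is d phi on the pair (v, w), so this is the structure equation for phi solved for [P]. *)
assert (E : P = qadd Q (qadd (qscal (kappa / 2) O)
   (qopp (qadd (qmul pv pw) (qopp (qmul pw pv)))))).
{ rewrite <- SP; generalize (qadd (qmul pv pw) (qopp (qmul pw pv))); clear; qring. }
subst P; clear SP.
qext; subst; qpair; ring.
Qed.

(** * The instanton equation *)

Lemma orthonormal_dual {V : Type} (g : V -> V -> R) (d : V) es :
  (forall i j, (i < length es)%nat -> (j < length es)%nat ->
     g (nth i es d) (nth j es d) = if Nat.eqb i j then 1 else 0) ->
  dual (map g es) es.
Proof.
induction es as [| v es IH]; intros H; [exact I |]; cbn [map dual]; split; [| split].
- apply (H 0%nat 0%nat); cbn; lia.
- intros m Hm; apply in_map_iff in Hm; destruct Hm as (u & <- & Hu).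
  destruct (In_nth es u d Hu) as (k & Hk & <-).
  apply (H (S k) 0%nat); cbn; lia.
- apply IH; intros i j Hi Hj; apply (H (S i) (S j)); cbn; lia.
Qed.

Lemma lsum_zero {T : AbelianMonoid} (l : list T) :
  (forall z, In z l -> z = zero) -> lsum l = zero.
Proof.
induction l as [| z l IH]; intros H; [reflexivity |].
cbn [lsum fold_right]; rewrite (H z) by (left; reflexivity).
rewrite plus_zero_l; apply IH; intros; apply H; right; assumption.
Qed.

Lemma unshuffles_length {V : Type} (vs : list V) s x y :
  In (s, x, y) (unshuffles vs) -> (length x + length y = length vs)%nat.
Proof.
revert s x y; induction vs as [| v vs IH]; intros s x y; cbn [unshuffles].
- intros [H | []]; injection H as <- <- <-; reflexivity.
- intros H; apply in_flat_map in H; destruct H as ([[s' x'] y'] & H & K).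
  apply IH in H; cbn [length]; rewrite <- H.
  destruct K as [K | [K | []]]; injection K as <- <- <-; cbn [length]; lia.
Qed.

(** No splitting of such a list consists of two singletons. *)
Lemma wedge_lin1_length {V : Type} {A B : AbelianMonoid} {C : ModuleSpace R_Ring}
  (mul : A -> B -> C) (c : V -> A) (d : V -> B) vs :
  (forall b, mul zero b = zero) -> (forall a, mul a zero = zero) ->
  length vs <> 2%nat -> wedge mul (lin1 c) (lin1 d) vs = zero.
Proof.
intros Hl Hr L; apply lsum_zero; intros z Hz; apply in_map_iff in Hz.
destruct Hz as ([[s x] y] & <- & H); apply unshuffles_length in H.
assert (E : mul (lin1 c x) (lin1 d y) = zero).
{ destruct x as [| u [| u' x]]; [apply Hl | | apply Hl].
  destruct y as [| w [| w' y]]; [apply Hr | | apply Hr].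
  cbn in H; lia. }
rewrite E; exact (scal_zero_r s).
Qed.

(** For a real-linear coordinate [q]; it reduces the quaternionic Hodge equation to four real
    ones. *)
Lemma wedgeRH_component (q : quat -> R) {V : Type} (a : alt V R) (b : alt V quat) vs :
  q (qreal 0) = 0 -> (forall y z, q (qadd y z) = q y + q z) ->
  (forall c y, q (qscal c y) = c * q y) ->
  q (wedgeRH a b vs) = wedgeR a (fun ws => q (b ws)) vs.
Proof.
intros Q0 QA QS; unfold wedgeRH, wedgeR, wedge, lsum; modE.
induction (unshuffles vs) as [| [[s x] y] L IH]; cbn [map fold_right]; [exact Q0 |].
rewrite QA, !QS, IH; reflexivity.
Qed.

Lemma dirDq_zero v x : dirDq (fun _ => qreal 0) v x = qreal 0.
Proof. apply is_dirDq_unique; split4; apply is_dirD_const. Qed.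

(** The wedge with [Psi] runs through sublists of every length, so the values of the curvature
    outside degree 2 enter as well. *)
Lemma curvature_length (A : point -> point -> quat) x vs : length vs <> 2%nat ->
  curvature A x vs = qreal 0.
Proof.
intros L; unfold curvature.
assert (W : wedgeH (quat_lin1 (A x)) (quat_lin1 (A x)) vs = qreal 0).
{ assert (Zl : forall b, qmul (qreal 0) b = qreal 0) by qring.
  assert (Zr : forall b, qmul b (qreal 0) = qreal 0) by qring.
  exact (wedge_lin1_length (A := quat_ModuleSpace) (B := quat_ModuleSpace)
    (C := quat_ModuleSpace) qmul _ _ _ Zl Zr L). }
assert (X : extd (fun y => quat_lin1 (A y)) x vs = qreal 0).
{ apply (lsum_zero (T := quat_ModuleSpace)); intros z Hz; apply in_map_iff in Hz.
  destruct Hz as (i & <- & Hi); apply in_seq in Hi.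
  assert (M : length (firstn i vs ++ skipn (S i) vs) <> 1%nat)
    by (rewrite length_app, length_firstn, length_skipn; lia).
  revert M; generalize (firstn i vs ++ skipn (S i) vs); intros ws M.
  replace (fun y => quat_lin1 (A y) ws) with (fun _ : point => qreal 0).
  - rewrite dirDq_zero; modE; clear; generalize ((-1) ^ i); qring.
  - apply functional_extensionality; intros y.
    destruct ws as [| u [| u' ws]]; try reflexivity; cbn in M; lia. }
rewrite W, X; clear; qring.
Qed.

(** [sd c] is -(1/2) c /\ conj(c), so left multiplication of [c] by [a] appears as [a] on the left
    and conj(a) on the right. *)
Lemma sd_qmul {V : Type} (a : quat) (c : V -> quat) v w :
  sd (fun u => qmul a (c u)) [v; w] = qmul (qmul a (sd c [v; w])) (qconj a).
Proof.
rewrite !sd_pair; generalize (c v) (c w); revert a; qring.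
Qed.

Lemma lambda21_length {V : Type} (a w : V -> quat) s t m1 m2 m3 n1 n2 n3 vs :
  length vs <> 2%nat -> lambda21 a w s t m1 m2 m3 n1 n2 n3 vs = 0.
Proof.
intros L.
assert (K : forall c d : V -> R, wedgeR (linA c) (linA d) vs = 0).
{ intros c d; exact (wedge_lin1_length (A := R_ModuleSpace) (B := R_ModuleSpace)
    (C := R_ModuleSpace) Rmult c d vs Rmult_0_l Rmult_0_r L). }
unfold lambda21, asd1, asd2, asd3, sd1, sd2, sd3, e0, e1, e2, e3.
change (@lin1 V R_ModuleSpace) with (@linA V); rewrite !K; ring.
Qed.

(** The exponents 3/5 and -2/5 differ by 1, hence tau / sigma = 5 kappa (1 + r) / 4; this ratio
    produces the term with 2/5 and 1 + r in the equation for [h]. *)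
Lemma sigma_tau kappa r : 0 <= r ->
  0 < sigma r /\ (0 < kappa -> 0 < tau kappa r) /\
  sigma r * (5 * kappa * (1 + r)) = 4 * tau kappa r.
Proof.
intros Hr; unfold sigma, tau.
assert (P : forall y, 0 < Rpower (1 + r) y) by (intros; apply exp_pos).
assert (E : Rpower (1 + r) (3 / 5) = Rpower (1 + r) (- (2 / 5)) * (1 + r)).
{ rewrite <- (Rpower_1 (1 + r)) at 3 by lra; rewrite <- Rpower_plus; f_equal; field. }
split; [| split].
- apply Rmult_lt_0_compat; [lra | apply P].
- intros Hk; apply Rmult_lt_0_compat; [lra | apply P].
- rewrite E; ring.
Qed.

(* With [F = p Omega + q B + (self-dual part)], the instanton equation says
   [p / tau = q / sigma], which is the hypothesis on the derivative of [h]. *)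
Lemma radial_conn_hodge kappa (h : R -> R) (dh : R) x : 0 < kappa -> total x ->
  is_derive h (radius2 x) dh ->
  (let r := radius2 x in
   r * dh = r * h r ^ 2 - 2 * h r + 2 / 5 * (1 - r * h r) / (1 + r)) ->
  is_hodge_star kappa x 6 (wedgeRH (Psi kappa x) (curvature (radial_conn h) x))
    (curvature (radial_conn h) x).
Proof.
intros Hk Hx Hh; cbv zeta; intros ODE E [L T O P].
set (r := radius2 x) in *.
assert (Hr : 0 <= r) by (unfold r; rewrite radius2E; apply qnorm2_ge0).
destruct (sigma_tau kappa r Hr) as (Hs & Ht & ST); specialize (Ht Hk).
set (s := sigma r) in *; set (t := tau kappa r) in *.
(* The common value of p / tau and q / sigma. Below, [rot] holds the images conj(a) e a of the
   units, and [lam q] is the real component [q] of the curvature as a member of the family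
   [lambda21]. *)
set (m := kappa / 2 * (1 - h r * r) / t).
set (N := dh + h r ^ 2).
set (a := fibre x).
set (rot := fun e => qmul (qmul (qconj a) e) a).
pose (lam := fun q : quat -> R => lambda21 (alpha x) (omega kappa x) s t
  (q (0, m, 0, 0)) (q (0, 0, m, 0)) (q (0, 0, 0, m))
  (N * q (rot (0, 1, 0, 0))) (N * q (rot (0, 0, 1, 0))) (N * q (rot (0, 0, 0, 1)))).
(* The curvature formula holds on tangent vectors, hence the restriction to sublists of the
   frame. *)
assert (C : forall ws, incl ws E -> curvature (radial_conn h) x ws =
  (lam q0 ws, lam q1 ws, lam q2 ws, lam q3 ws)).
{ intros ws Hws; unfold lam.
  destruct (Nat.eq_dec (length ws) 2) as [L2 | L2].
  - destruct ws as [| v [| w [| ? ?]]]; try discriminate.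
    rewrite (radial_conn_curvature kappa h dh) by
      (assumption || (apply T, Hws; cbn; tauto)).
    cbv zeta; fold r.
    replace (kappa / 2 * (1 - h r * r)) with (t * m) by (unfold m; field; lra).
    (* This is where the differential equation for [h] enters, together with the ratio of [s] and
       [t]. *)
    replace (2 * h r + dh * r - h r ^ 2 * r) with (s * m).
    2: { rewrite (Rmult_comm dh), ODE; unfold m.
         replace t with (s * (5 * kappa * (1 + r)) / 4) by lra; field; lra. }
    rewrite sd_qmul; fold a N.
    replace (qconj (qconj a)) with a by (clear; generalize a; qring).
    unfold lambda21, sd, asd, rot.
    generalize (asd1 (alpha x) [v; w]) (asd2 (alpha x) [v; w]) (asd3 (alpha x) [v; w]).
    generalize (asd1 (omega kappa x) [v; w]) (asd2 (omega kappa x) [v; w])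
      (asd3 (omega kappa x) [v; w]).
    generalize (sd1 (alpha x) [v; w]) (sd2 (alpha x) [v; w]) (sd3 (alpha x) [v; w]).
    clearbody a N m; clear; intros; qext; qpair; ring.
  - rewrite curvature_length, !lambda21_length by exact L2; reflexivity. }
destruct E as [| v0 [| v1 [| v2 [| v3 [| v4 [| v5 [| v6 [| v7 [| ? ?]]]]]]]]];
  try discriminate L.
assert (D := orthonormal_dual (metric (alpha x) (omega kappa x) s t) zero _
  ltac:(rewrite L; exact O)).
assert (W := orthonormal_cayley_volume (alpha x) (omega kappa x) s t _ Hs Ht
  ltac:(intros y z; destruct (horizontal_lift kappa x y z Hk Hx) as (v & _ & H);
        exists v; exact H)
  L D P).
assert (K : forall q : quat -> R,
  q (qreal 0) = 0 -> (forall y z, q (qadd y z) = q y + q z) ->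
  (forall c y, q (qscal c y) = c * q y) ->
  (forall ws, incl ws [v0; v1; v2; v3; v4; v5; v6; v7] ->
     q (curvature (radial_conn h) x ws) = lam q ws) ->
  q (curvature (radial_conn h) x [v6; v7]) =
  q (wedgeRH (Psi kappa x) (curvature (radial_conn h) x) [v0; v1; v2; v3; v4; v5])).
{ intros q Q0 QA QS QC.
  rewrite wedgeRH_component, QC by (assumption || (intros y; cbn; tauto)).
  rewrite (wedgeR_extr _ _ (lam q)).
  - symmetry; exact (hodge_pointwise _ _ _ _ _ _ _ _ _ _ _ _ _ _ _ _ _ _ D W).
  - intros ws Hws; apply QC; intros y Hy; apply Hws in Hy; clear - Hy; cbn in *; tauto. }
cbn [firstn skipn].
apply quat_eq; apply K; try reflexivity; intros ws Hws; rewrite C by exact Hws; reflexivity.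
Qed.

(** * The Riccati equation for [f] *)

Lemma f_gap D r : 0 < r -> 1 + D * Rpower (1 + r) (3 / 5) <> 0 ->
  1 - r * f D r =
  3 * D * Rpower (1 + r) (3 / 5) * r / (5 * (1 + r) * (1 + D * Rpower (1 + r) (3 / 5))).
Proof.
intros Hr Hd; unfold f.
assert (P : 0 < Rpower (1 + r) (3 / 5)) by apply exp_pos.
replace (Rpower (1 + r) (2 / 5)) with ((1 + r) / Rpower (1 + r) (3 / 5)).
- field; repeat split; lra.
- apply Rmult_eq_reg_r with (Rpower (1 + r) (3 / 5)); [| lra].
  rewrite <- Rpower_plus; replace (2 / 5 + 3 / 5) with 1 by field.
  rewrite Rpower_1 by lra; field; lra.
Qed.

(** With z = (1 + r)^(3/5), the other power is (1 + r) / z and z' = (3/5) z / (1 + r), so the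
    equation is a rational identity in r, z and D. *)
Lemma f_ode D r : 0 < r -> 1 + D * Rpower (1 + r) (3 / 5) <> 0 ->
  exists df, is_derive (f D) r df /\
  r * df = r * f D r ^ 2 - 2 * f D r + 2 / 5 * (1 - r * f D r) / (1 + r).
Proof.
intros Hr Hd.
assert (P : 0 < exp (3 / 5 * ln (1 + r))) by apply exp_pos.
assert (Q : 0 < exp (2 / 5 * ln (1 + r))) by apply exp_pos.
assert (E : exp (2 / 5 * ln (1 + r)) = (1 + r) / exp (3 / 5 * ln (1 + r))).
{ apply Rmult_eq_reg_r with (exp (3 / 5 * ln (1 + r))); [| lra].
  rewrite <- exp_plus.
  replace (2 / 5 * ln (1 + r) + 3 / 5 * ln (1 + r)) with (ln (1 + r)) by field.
  rewrite exp_ln by lra; field; lra. }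
eexists; split.
- unfold f, Rpower; auto_derive.
  + fold (Rpower (1 + r) (3 / 5)); repeat split; try lra;
      repeat apply Rmult_integral_contrapositive_currified; try lra; exact Hd.
  + reflexivity.
- unfold f, Rpower in *; unfold Rdiv in *; rewrite E; revert P Hd.
  generalize (exp (3 * / 5 * ln (1 + r))); intros z P Hd.
  field; repeat split; lra.
Qed.

(** * Smoothness *)

Section Smoothness.
Variable U : point -> Prop.

(** A class containing the coefficients of the connection and closed, on [U], under directional
    derivatives; smoothness then follows by induction on the order. Denominators and bases of powers
    are constrained on [U] only. *)
Inductive elementary : (point -> R) -> Prop :=
  | elementary_const c : elementary (fun _ => c)
  | elementary_linear (F : point -> R) : (forall x : point, continuous F x) ->
      (forall (x v : point) (t : R), F (plus x (scal t v)) = F x + t * F v) -> elementary F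
  | elementary_opp F : elementary F -> elementary (fun x => - F x)
  | elementary_plus F G : elementary F -> elementary G -> elementary (fun x => F x + G x)
  | elementary_mult F G : elementary F -> elementary G -> elementary (fun x => F x * G x)
  | elementary_inv F : (forall x, U x -> F x <> 0) -> elementary F ->
      elementary (fun x => / F x)
  | elementary_Rpower F c : (forall x, U x -> 0 < F x) -> elementary F ->
      elementary (fun x => Rpower (F x) c).

Lemma is_derive_Rpower y c : 0 < y ->
  is_derive (fun z => Rpower z c) y (c * Rpower y (c - 1)).
Proof.
intros Hy; apply is_derive_Reals, derivable_pt_lim_power, Hy.
Qed.

Lemma elementary_continuous F x : elementary F -> U x -> continuous F x.
Proof.
intros H Ux; induction H as [c | F C _ | F _ IH | F G _ IF _ IG | F G _ IF _ IG
                            | F N _ IH | F c N _ IH].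
- apply continuous_const.
- apply C.
- apply (continuous_opp (V := R_NormedModule)), IH.
- apply (continuous_plus (V := R_NormedModule)); assumption.
- apply (continuous_mult (K := R_AbsRing)); assumption.
- apply (continuous_comp F Rinv); [exact IH |].
  apply continuous_Rinv, N, Ux.
- apply (continuous_comp F (fun z => Rpower z c)); [exact IH |].
  apply (ex_derive_continuous (V := R_NormedModule)).
  eexists; apply is_derive_Rpower, N, Ux.
Qed.

Lemma elementary_dirD F v : elementary F ->
  exists G, elementary G /\ forall x, U x -> is_dirD F v x (G x).
Proof.
intros H; induction H as [c | F C L | F HF IF | F G HF IF HG IG | F G HF IF HG IG
                         | F N HF IF | F c N HF IF].
- exists (fun _ => 0); split; [apply elementary_const | intros; apply is_dirD_const].
- exists (fun _ => F v); split; [apply elementary_const | intros x _].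
  apply is_derive_ext with (fun t : R => F x + t * F v); [intros t; symmetry; apply L |].
  auto_derive; trivial; ring.
- destruct IF as (F' & E & D); exists (fun x => - F' x); split.
  + apply elementary_opp, E.
  + intros; apply is_dirD_opp; auto.
- destruct IF as (F' & E & D), IG as (G' & E' & D'); exists (fun x => F' x + G' x); split.
  + apply elementary_plus; assumption.
  + intros; apply is_dirD_plus; auto.
- destruct IF as (F' & E & D), IG as (G' & E' & D').
  exists (fun x => F' x * G x + F x * G' x); split.
  + apply elementary_plus; apply elementary_mult; assumption.
  + intros; apply is_dirD_mult; auto.
- destruct IF as (F' & E & D).
  exists (fun x => F' x * - (/ F x * / F x)); split.
  + apply elementary_mult; [exact E |].
    apply elementary_opp, elementary_mult; apply elementary_inv; assumption.
  + intros x Ux; apply (is_dirD_comp Rinv); auto.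
    specialize (N x Ux); auto_derive; [exact N | field; exact N].
- destruct IF as (F' & E & D).
  exists (fun x => F' x * (c * Rpower (F x) (c - 1))); split.
  + apply elementary_mult; [exact E |].
    apply elementary_mult; [apply elementary_const | apply elementary_Rpower; assumption].
  + intros x Ux; apply (is_dirD_comp (fun z => Rpower z c)); auto.
    apply is_derive_Rpower; auto.
Qed.

Hypothesis U_open : forall x, U x -> locally x U.

Let quat_NM := prod_NormedModule R_AbsRing (prod_NormedModule R_AbsRing
  (prod_NormedModule R_AbsRing R_NormedModule R_NormedModule) R_NormedModule) R_NormedModule.
Let point_NM := prod_NormedModule R_AbsRing
  (prod_NormedModule R_AbsRing (prod_NormedModule R_AbsRing quat_NM quat_NM)
     (prod_NormedModule R_AbsRing quat_NM quat_NM)) quat_NM.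

(** A line through a point of the open set stays in it for small times, so functions equal on [U]
    have equal directional derivatives there. *)
Lemma line_locally x v : U x -> locally 0 (fun t : R => U (plus x (scal t v))).
Proof.
intros Ux.
assert (C : continuous (fun t : R => plus x (scal t v) : point_NM) 0).
{ apply (continuous_plus (V := point_NM) (fun _ : R => x) (fun t : R => scal t v : point_NM)).
  - apply continuous_const.
  - apply (continuous_scal_l (V := point_NM) (fun t : R => t) v), continuous_id. }
apply C.
change (locally (plus x (scal 0 v)) U); rewrite line_0; apply U_open, Ux.
Qed.

(** Agreement on [U] is the right induction hypothesis: [dirD F v] is known to equal an elementary
    function only there. *)
Lemma elementary_smooth F G : elementary G -> (forall x, U x -> F x = G x) -> smooth U F.
Proof.
intros HG E k; revert F G HG E; induction k as [| k IH]; intros F G HG E.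
all: assert (C : forall x, U x -> continuous F x) by
  (intros x Ux; apply continuous_ext_loc with G;
   [destruct (U_open x Ux) as [e He]; exists e; intros y Hy; symmetry; apply E, He, Hy
   | apply elementary_continuous; assumption]).
- split; [exact C | exact I].
- split; [exact C |]; intros v.
  destruct (elementary_dirD G v HG) as (G' & HG' & D).
  assert (D' : forall x, U x -> is_dirD F v x (G' x)).
  { intros x Ux; apply is_derive_ext_loc with (fun t : R => G (plus x (scal t v))).
    - destruct (line_locally x v Ux) as [e He]; exists e; intros t Hs.
      symmetry; apply E, He, Hs.
    - apply D, Ux. }
  split.
  + intros x Ux; exists (G' x); apply D', Ux.
  + apply IH with G'; [exact HG' | intros; apply is_dirD_unique, D'; assumption].
Qed.

Lemma elementary_neq0 F x : elementary F -> U x -> F x <> 0 -> locally x (fun y => F y <> 0).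
Proof.
intros HF Ux Fx.
exact (elementary_continuous F x HF Ux (fun z => z <> 0) (open_neq 0 (F x) Fx)).
Qed.

Definition elementaryq (F : point -> quat) : Prop :=
  elementary (fun x => q0 (F x)) /\ elementary (fun x => q1 (F x)) /\
  elementary (fun x => q2 (F x)) /\ elementary (fun x => q3 (F x)).

Lemma elementaryq_const c : elementaryq (fun _ => c).
Proof. split4; apply elementary_const. Qed.

Lemma elementaryq_add F G : elementaryq F -> elementaryq G ->
  elementaryq (fun x => qadd (F x) (G x)).
Proof.
intros (F0 & F1 & F2 & F3) (G0 & G1 & G2 & G3); split4; apply elementary_plus; assumption.
Qed.

Lemma elementaryq_opp F : elementaryq F -> elementaryq (fun x => qopp (F x)).
Proof. intros (F0 & F1 & F2 & F3); split4; apply elementary_opp; assumption. Qed.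

Lemma elementaryq_conj F : elementaryq F -> elementaryq (fun x => qconj (F x)).
Proof.
intros (F0 & F1 & F2 & F3); split4; [exact F0 | apply elementary_opp; assumption ..].
Qed.

Lemma elementaryq_im F : elementaryq F -> elementaryq (fun x => qim (F x)).
Proof. intros (F0 & F1 & F2 & F3); split4; [exact (elementary_const 0) | assumption ..]. Qed.

Lemma elementaryq_scal F G : elementary F -> elementaryq G ->
  elementaryq (fun x => qscal (F x) (G x)).
Proof.
intros HF (G0 & G1 & G2 & G3); split4; apply elementary_mult; assumption.
Qed.

Lemma elementaryq_mul F G : elementaryq F -> elementaryq G ->
  elementaryq (fun x => qmul (F x) (G x)).
Proof.
intros (F0 & F1 & F2 & F3) (G0 & G1 & G2 & G3).
assert (K : forall A B A' B' C D C' D', elementary A -> elementary B -> elementary C ->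
  elementary D -> elementary A' -> elementary B' -> elementary C' -> elementary D' ->
  elementary (fun x => A x * A' x - B x * B' x - C x * C' x - D x * D' x) /\
  elementary (fun x => A x * A' x + B x * B' x + C x * C' x - D x * D' x) /\
  elementary (fun x => A x * A' x - B x * B' x + C x * C' x + D x * D' x) /\
  elementary (fun x => A x * A' x + B x * B' x - C x * C' x + D x * D' x)).
{ intros A B A' B' C D C' D' HA HB HC HD HA' HB' HC' HD'; unfold Rminus.
  split4; repeat first [apply elementary_mult; assumption
    | apply elementary_opp | apply elementary_plus]. }
split4; apply (K _ _ _ _ _ _ _ _); assumption.
Qed.

Lemma continuous_fst' {A B : UniformSpace} (z : prod_UniformSpace A B) :
  continuous (fun y : prod_UniformSpace A B => fst y) z.
Proof. destruct z; apply continuous_fst. Qed.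

Lemma continuous_snd' {A B : UniformSpace} (z : prod_UniformSpace A B) :
  continuous (fun y : prod_UniformSpace A B => snd y) z.
Proof. destruct z; apply continuous_snd. Qed.

Ltac continuous_projection :=
  first [apply continuous_id | apply continuous_fst' | apply continuous_snd'
    | match goal with
      | |- continuous (fun y => fst (@?F y)) _ =>
          apply (continuous_comp F (fun z => fst z));
            [continuous_projection | apply continuous_fst']
      | |- continuous (fun y => snd (@?F y)) _ =>
          apply (continuous_comp F (fun z => snd z));
            [continuous_projection | apply continuous_snd']
      end].

Ltac elementary_coordinates :=
  split4; (apply elementary_linear;
    [intros x; unfold q0, q1, q2, q3, m11, m12, m21, m22, fibre; continuous_projection
    | reflexivity]).

Lemma elementaryq_m12 : elementaryq (fun x => m12 (fst x)).
Proof. elementary_coordinates. Qed.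

Lemma elementaryq_m22 : elementaryq (fun x => m22 (fst x)).
Proof. elementary_coordinates. Qed.

Lemma elementaryq_fibre : elementaryq fibre.
Proof. elementary_coordinates. Qed.

Lemma elementary_radius2 : elementary radius2.
Proof.
exact (proj1 (elementaryq_mul _ _ elementaryq_fibre (elementaryq_conj _ elementaryq_fibre))).
Qed.

Lemma elementaryq_phi v : elementaryq (fun x => phi x v).
Proof.
exact (elementaryq_add _ _
  (elementaryq_mul _ _ (elementaryq_conj _ elementaryq_m12) (elementaryq_const (m12 (fst v))))
  (elementaryq_mul _ _ (elementaryq_conj _ elementaryq_m22) (elementaryq_const (m22 (fst v))))).
Qed.

Lemma elementaryq_A2 v : elementaryq (fun x => A2 x v).
Proof.
apply elementaryq_im, (elementaryq_mul (fun x => qconj (fibre x)) (fun x => alpha x v)).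
- apply elementaryq_conj, elementaryq_fibre.
- exact (elementaryq_add _ _ (elementaryq_const (snd v))
    (elementaryq_opp _ (elementaryq_mul _ _ elementaryq_fibre (elementaryq_phi v)))).
Qed.
End Smoothness.

Lemma radius2_ge0 x : 0 <= radius2 x.
Proof. rewrite radius2E; apply qnorm2_ge0. Qed.

Definition pole (D : R) (x : point) : R := 1 + D * Rpower (1 + radius2 x) (3 / 5).

Lemma elementary_pole U D : elementary U (pole D).
Proof.
apply elementary_plus; [apply elementary_const |].
apply elementary_mult; [apply elementary_const |].
apply elementary_Rpower.
- intros x _; pose proof (radius2_ge0 x); lra.
- apply elementary_plus; [apply elementary_const | apply elementary_radius2].
Qed.

(** Both [radius2] and [pole D] are continuous on the whole space, since 1 + r is positive
    everywhere. *)
Lemma domain_open D x : domain D x -> locally x (domain D).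
Proof.
intros [H1 H2].
destruct (elementary_neq0 (fun _ => True) radius2 x (elementary_radius2 _) I H1) as [e1 E1].
destruct (elementary_neq0 (fun _ => True) (pole D) x (elementary_pole _ D) I H2) as [e2 E2].
assert (He : 0 < Rmin e1 e2) by (apply Rmin_case; apply cond_pos).
exists (mkposreal _ He); intros y Hy; split.
- apply E1; revert Hy; apply ball_le, Rmin_l.
- apply E2; revert Hy; apply ball_le, Rmin_r.
Qed.

Lemma elementary_f (U : point -> Prop) D : (forall x, U x -> domain D x) ->
  elementary U (fun x => f D (radius2 x)).
Proof.
intros HU; unfold f, Rdiv.
assert (E1 : forall c, elementary U (fun x => Rpower (1 + radius2 x) c)).
{ intros c; apply elementary_Rpower.
  - intros x _; pose proof (radius2_ge0 x); lra.
  - apply elementary_plus; [apply elementary_const | apply elementary_radius2]. }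
assert (N : forall x, U x -> radius2 x <> 0 /\ pole D x <> 0) by (intros x Hx; apply HU, Hx).
assert (P : forall x c, Rpower (1 + radius2 x) c <> 0)
  by (intros; apply Rgt_not_eq, exp_pos).
assert (ER := elementary_radius2 U); assert (EP := elementary_pole U D).
apply elementary_plus; apply elementary_mult.
- apply elementary_const.
- apply elementary_inv.
  + intros x Hx; apply Rmult_integral_contrapositive; apply N, Hx.
  + apply elementary_mult; assumption.
- apply elementary_mult; [apply elementary_const |].
  apply elementary_plus; [apply elementary_mult |]; assumption || apply elementary_const.
- apply elementary_inv.
  + intros x Hx; destruct (N x Hx).
    repeat apply Rmult_integral_contrapositive_currified; auto; lra.
  + repeat apply elementary_mult; try assumption; [apply elementary_const | apply E1].
Qed.

(** * The connection form *)

(** Describing [U] by an equivalence lets the result serve both for [domain D] and, when D is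
    nonnegative, for [off_zero_section]. *)
Lemma Aconn_smooth U D v : (forall x, U x <-> domain D x) -> smoothq U (fun x => Aconn D x v).
Proof.
intros HU.
assert (O : forall x, U x -> locally x U).
{ intros x Hx; destruct (domain_open D x (proj1 (HU x) Hx)) as [e He].
  exists e; intros y Hy; apply HU, He, Hy. }
destruct (elementaryq_add U _ _ (elementaryq_phi U v)
  (elementaryq_scal U _ _ (elementary_f U D (fun x => proj1 (HU x))) (elementaryq_A2 U v)))
  as (E0 & E1 & E2 & E3).
split4; [exact (elementary_smooth U O _ _ E0 (fun _ _ => eq_refl))
  | exact (elementary_smooth U O _ _ E1 (fun _ _ => eq_refl))
  | exact (elementary_smooth U O _ _ E2 (fun _ _ => eq_refl))
  | exact (elementary_smooth U O _ _ E3 (fun _ _ => eq_refl))].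
Qed.

Lemma phi_plus x (v w : point) : phi x (plus v w) = qadd (phi x v) (phi x w).
Proof.
assert (E : forall u : point, m12 (fst u) = qadd (m12 (fst v)) (m12 (fst w)) ->
  m22 (fst u) = qadd (m22 (fst v)) (m22 (fst w)) -> phi x u = qadd (phi x v) (phi x w)).
{ intros u H1 H2; unfold phi, maurer_cartan, mmul; cbn [m22 fst snd].
  rewrite H1, H2, !qmul_qadd_r; apply qadd_swap. }
apply E; reflexivity.
Qed.

Lemma phi_scal x (c : R) (v : point) : phi x (scal c v) = qscal c (phi x v).
Proof.
assert (E : forall u : point, m12 (fst u) = qscal c (m12 (fst v)) ->
  m22 (fst u) = qscal c (m22 (fst v)) -> phi x u = qscal c (phi x v)).
{ intros u H1 H2; unfold phi, maurer_cartan, mmul; cbn [m22 fst snd].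
  rewrite H1, H2, !qmul_qscal_r.
  assert (S : forall p q, qadd (qscal c p) (qscal c q) = qscal c (qadd p q)) by (clear; qring).
  apply S. }
apply E; reflexivity.
Qed.

Lemma phi_act p q x v : phi (act p q x) (act p q v) = qmul (qmul (qconj q) (phi x v)) q.
Proof.
unfold phi, act, maurer_cartan; cbn [fst snd].
rewrite madj_mmul, <- mmul_assoc, (mmul_assoc (madj (fst x))), madj_mdiag.
generalize (mmul (madj (fst x)) (fst v)); clear.
intros [[? ?] [? ?]]; unfold mmul, mdiag, m11, m12, m21, m22; cbn [fst snd].
rewrite ?qmul_qreal_l, ?qmul_qreal_r, ?qmul_qadd_r, ?qmul_qscal_r, ?qmul_qscal_l, ?qmul_assoc.
qlin.
Qed.

(** In a q conj(q) phi q the inner factor q conj(q) is 1. *)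
Lemma alpha_act p q x v : SU2 q -> alpha (act p q x) (act p q v) = qmul (alpha x v) q.
Proof.
intros Hq; apply SU2_norm in Hq; unfold alpha; rewrite phi_act.
unfold fibre, act; cbn [snd].
rewrite !qmul_assoc, <- (qmul_assoc (snd x) q), qmul_qconj_r, Hq, qmul_qreal_r.
generalize (snd x) (snd v) (phi x v); revert q Hq; clear; intros q _; revert q; qring.
Qed.

Lemma radius2_act p q x : SU2 q -> radius2 (act p q x) = radius2 x.
Proof.
intros Hq; apply SU2_norm in Hq; rewrite !radius2E; unfold fibre, act; cbn [snd].
rewrite qnorm2_qmul, Hq; ring.
Qed.

(** Conjugation by [q] commutes with the imaginary part, and r is invariant. Taking q = 1 gives
    descent to the quotient by the first factor, p = 1 gives equivariance. *)
Lemma Aconn_act D p q x v : SU2 q ->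
  Aconn D (act p q x) (act p q v) = qmul (qmul (qconj q) (Aconn D x v)) q.
Proof.
intros Hq; unfold Aconn, A2; rewrite phi_act, alpha_act, radius2_act by exact Hq.
change (fibre (act p q x)) with (qmul (fibre x) q); rewrite qconj_qmul.
replace (qmul (qmul (qconj q) (qconj (fibre x))) (qmul (alpha x v) q))
  with (qmul (qmul (qconj q) (qmul (qconj (fibre x)) (alpha x v))) q)
  by (rewrite !qmul_assoc; reflexivity).
generalize (qmul (qconj (fibre x)) (alpha x v)) (phi x v) (f D (radius2 x)); clear Hq.
revert q; clear; qring.
Qed.

Lemma phi_vertical x X Y : total x -> phi x (vertical X Y x) = Y.
Proof.
intros [H _]; unfold phi, vertical, maurer_cartan; cbn [fst snd].
rewrite mmul_assoc, H, mmul_1l; reflexivity.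
Qed.

(** On a vertical vector alpha is a Y - a Y = 0, so only phi contributes. *)
Lemma Aconn_vertical D x X Y : total x -> Aconn D x (vertical X Y x) = Y.
Proof.
intros Hx; unfold Aconn, A2, alpha; rewrite phi_vertical by exact Hx.
unfold vertical; cbn [snd]; fold (fibre x).
generalize (f D (radius2 x)) (fibre x); revert Y; clear; qring.
Qed.

Lemma Aconn_connection U D : (forall x, U x <-> domain D x) -> is_connection U (Aconn D).
Proof.
intros HU; split.
- intros x v w _; unfold Aconn, A2, alpha; rewrite phi_plus.
  change (snd (plus v w)) with (qadd (@snd mat2 quat v) (@snd mat2 quat w)).
  generalize (phi x v) (phi x w) (@snd mat2 quat v) (@snd mat2 quat w)
    (fibre x) (f D (radius2 x)); clear; qring.
- intros x c v _; unfold Aconn, A2, alpha; rewrite phi_scal.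
  change (snd (scal c v)) with (qscal c (@snd mat2 quat v)).
  generalize (phi x v) (@snd mat2 quat v) (fibre x) (f D (radius2 x)); revert c; clear; qring.
- intros v; apply Aconn_smooth, HU.
- intros x v _ _ Hv; unfold imaginary, Aconn, A2; assert (H := phi_imaginary x v Hv).
  change (q0 (phi x v) + f D (radius2 x) * 0 = 0); rewrite H; ring.
- intros x X Hx _ _; apply Aconn_vertical, Hx.
- intros x v p _ _ _ _; rewrite Aconn_act by (clear; unfold SU2; qring).
  generalize (Aconn D x v); clear; qring.
- intros x X Hx _ _; apply Aconn_vertical, Hx.
- intros x v q _ _ _ Hq; apply Aconn_act, Hq.
Qed.

(** * The instanton equation and non-flatness for [Aconn] *)

Lemma radius2_pos x : off_zero_section x -> 0 < radius2 x.
Proof. intros H; destruct (radius2_ge0 x); [assumption | symmetry in H0; contradiction]. Qed.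

Lemma Aconn_instanton kappa D U : 0 < kappa -> (forall x, U x <-> domain D x) ->
  is_Spin7_instanton kappa U (Aconn D).
Proof.
intros Hk HU; split; [apply Aconn_connection, HU |].
intros x Hx Ux; apply HU in Ux; destruct Ux as [Hr Hd]; apply radius2_pos in Hr.
destruct (f_ode D (radius2 x) Hr Hd) as (df & Hf & ODE).
exact (radial_conn_hodge kappa (f D) df x Hk Hx Hf ODE).
Qed.

(** On vectors annihilated by alpha only the Omega-term of the curvature survives, and [f_gap] shows
    that its coefficient is nonzero. *)
Lemma Aconn_not_flat kappa D : 0 < kappa -> D <> 0 -> ~ is_flat (domain D) (Aconn D).
Proof.
intros Hk HD Fl.
(* The second denominator of [f] is strictly monotone in r when D is nonzero, so at most one of r =
   1 and r = 4 is a pole. *)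
assert (Hc : exists c, 0 < c /\ 1 + D * Rpower (1 + c * c) (3 / 5) <> 0).
{ destruct (Req_dec (1 + D * Rpower (1 + 1 * 1) (3 / 5)) 0) as [E1 | N1].
  2: { exists 1; split; [lra | exact N1]. }
  exists 2; split; [lra | intros E2].
  assert (M := Rlt_Rpower_l (1 + 1 * 1) (1 + 2 * 2) (3 / 5) ltac:(lra) ltac:(lra)).
  assert (Z : D * (Rpower (1 + 2 * 2) (3 / 5) - Rpower (1 + 1 * 1) (3 / 5)) = 0) by lra.
  apply Rmult_integral in Z; destruct Z; [contradiction | lra]. }
destruct Hc as (c & Hc & Hd).
set (x := ((qreal 1, qreal 0), (qreal 0, qreal 1), qreal c) : point).
assert (Hx : total x).
{ split; clear; unfold mmul, madj, mdiag, m11, m12, m21, m22; cbn [fst snd x];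
    repeat apply (f_equal2 (@pair _ _)); qext; try qpair; ring. }
assert (Er : radius2 x = c * c) by (rewrite radius2E; unfold qnorm2; cbn; ring).
assert (Hr : 0 < c * c) by (apply Rmult_lt_0_compat; exact Hc).
rewrite <- Er in Hr, Hd.
(* Lifts with omega equal to 1 and i, so that Omega^1 takes the value 1 on the pair. *)
destruct (horizontal_lift kappa x (qreal 0) (1, 0, 0, 0) Hk Hx) as (v & Tv & Av & Wv).
destruct (horizontal_lift kappa x (qreal 0) (0, 1, 0, 0) Hk Hx) as (w & Tw & Aw & Ww).
destruct (f_ode D (radius2 x) Hr Hd) as (df & Hf & _).
assert (C := Fl x v w Hx (conj (Rgt_not_eq _ _ Hr) Hd) Tv Tw).
change (Aconn D) with (radial_conn (f D)) in C.
rewrite (radial_conn_curvature kappa (f D) df) in C by assumption.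
cbv zeta in C; rewrite !asd_pair, sd_pair, Av, Aw, Wv, Ww in C.
apply (f_equal q1) in C.
assert (K : kappa / 2 * (1 - radius2 x * f D (radius2 x)) = 0).
{ refine (eq_trans _ C); generalize (fibre x) (f D (radius2 x)) (radius2 x); clear; intros.
  qext; ring. }
rewrite f_gap in K by assumption.
revert K; apply Rmult_integral_contrapositive_currified; [lra |].
assert (0 < Rpower (1 + radius2 x) (3 / 5)) by apply exp_pos.
unfold Rdiv; repeat apply Rmult_integral_contrapositive_currified; try lra; try assumption.
apply Rinv_neq_0_compat.
repeat apply Rmult_integral_contrapositive_currified; try lra; try assumption.
Qed.

(** Non-triviality is expressed as non-flatness and claimed for nonzero D, the connection being flat
    at D = 0 by [flat_D0]. For -1 < D < 0 the set [domain D] also leaves out the second pole found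
    in [domain_neg]. *)
Theorem theorem1p3 (kappa D : R) (hkappa : 0 < kappa) (hD : -1 < D) :
  is_Spin7_instanton kappa (domain D) (Aconn D) /\
  (0 <= D -> is_Spin7_instanton kappa off_zero_section (Aconn D)) /\
  (D <> 0 -> ~ is_flat (domain D) (Aconn D)).
Proof.
split; [| split].
- apply Aconn_instanton; [exact hkappa | reflexivity].
- intros H; apply Aconn_instanton; [exact hkappa |].
  intros x; symmetry; apply domain_nonneg, H.
- apply (Aconn_not_flat kappa), hkappa.
Qed.
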